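(* Let $z\in\mathbb{C}\setminus[0,1]$. Let $\tau$ be the anti-automorphism of the $\mathbb{Q}$-algebra $\mathcal{A}=\mathbb{Q}\langle e_0,e_1,e_z\rangle$ (i.e. $\tau(xy)=\tau(y)\tau(x)$ for all $x,y\in\mathcal{A}$) given by $$\tau(e_0)=e_z-e_1,\qquad \tau(e_1)=e_z-e_0,\qquad \tau(e_z)=e_z.$$ Then, for any $w\in\mathcal{A}^0$, $$L(w-\tau(w))=0.$$
   Context: Let $z\in\mathbb{C}\setminus[0,1]$. For $a_1,\dots,a_n\in\{0,1,z\}$ with $a_1\neq 0$ and $a_n\neq 1$, define the (absolutely convergent) iterated integral $$I(0;a_1,\dots,a_n;1)=\int_{0<t_1<t_2<\cdots<t_n<1}\ \prod_{i=1}^n\frac{dt_i}{t_i-a_i}.$$ $\mathcal{A}=\mathbb{Q}\langle e_0,e_1,e_z\rangle$ is the non-commutative polynomial algebra over $\mathbb{Q}$ in three formal letters $e_0,e_1,e_z$, and $$\mathcal{A}^0=\mathbb{Q}+\mathbb{Q}e_z+e_z\mathcal{A}e_z+e_z\mathcal{A}e_0+e_1\mathcal{A}e_z+e_1\mathcal{A}e_0$$ is the linear subspace spanned by convergent words, i.e. the empty word and the words $e_{a_1}\cdots e_{a_n}$ with $a_1\ne 0$, $a_n\neq 1$. The $\mathbb{Q}$-linear map $L$ on $\mathcal{A}^0$ is defined by $L(1)=1$ and $L(e_{a_1}e_{a_2}\cdots e_{a_n})=I(0;a_1,a_2,\dots,a_n;1)$ for words in $\mathcal{A}^0$. The map $\tau$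 sends $\mathcal{A}^0$ to itself, so $L(w-\tau(w))$ makes sense for $w\in\mathcal{A}^0$. *)

(* Defs.v *)
From HB Require Import structures.
From mathcomp Require Import all_boot all_order all_algebra.
From mathcomp Require Import finmap.
From mathcomp Require Import monalg.
From mathcomp Require Import complex.
From mathcomp Require Import all_classical all_reals all_analysis.

Set Implicit Arguments.
Unset Strict Implicit.
Unset Printing Implicit Defensive.

Import Order.TTheory GRing.Theory Num.Theory.
Import numFieldNormedType.Exports.

Local Open Scope classical_set_scope.
Local Open Scope ring_scope.

Lemma malg_scalerAr (K : monomType) (R : comNzRingType) (c : R)
    (x y : {malg R[K]}) : c *: (x * y) = x * (c *: y).
Proof.
apply/malgP => k; rewrite mcoeffZ mcoeffMl.
rewrite (mcoeffMlw _ (fsubset_refl _) (msuppZ_le c y)) mulr_sumr.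
apply: eq_bigr => k1 _; rewrite mulr_sumr; apply: eq_bigr => k2 _.
by rewrite mcoeffZ -mulrnAr mulrnAr mulrCA mulrnAr.
Qed.

Lemma malg_sumE (K : choiceType) (R : nzRingType) (x : {malg R[K]}) :
  x = \sum_(m <- msupp x) x@_m *: << m >>.
Proof.
rewrite [LHS]monalgE; apply: eq_bigr => m _.
by apply/malgP => k; rewrite mcoeffZ !mcoeffU mulr_natr.
Qed.

Lemma malg_scaleM (K : monomType) (R : comNzRingType) (c d : R)
    (x y : {malg R[K]}) : (c *: x) * (d *: y) = (c * d) *: (x * y).
Proof. by rewrite -scalerAl -malg_scalerAr scalerA. Qed.

Lemma malg_mulE (K : monomType) (R : comNzRingType) (x y : {malg R[K]}) :
  x * y = \sum_(m1 <- msupp x) \sum_(m2 <- msupp y)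
            (x@_m1 * y@_m2) *: << mmul m1 m2 >>.
Proof.
rewrite [LHS]malgME; apply: eq_bigr => m1 _; apply: eq_bigr => m2 _.
by apply/malgP => k; rewrite mcoeffZ !mcoeffU mulr_natr.
Qed.

Lemma malg_monomM (K : monomType) (R : comNzRingType) (k1 k2 : K) :
  << k1 >> * << k2 >> = << mmul k1 k2 >> :> {malg R[K]}.
Proof. by rewrite malgM_def fgmulUU mulr1. Qed.

Inductive letter := l0 | l1 | lz.

Definition letter_code (l : letter) : 'I_3 :=
  match l with l0 => inord 0 | l1 => inord 1 | lz => inord 2 end.

Definition letter_decode (i : 'I_3) : letter :=
  match nat_of_ord i with 0 => l0 | 1 => l1 | _ => lz end%N.

Lemma letter_codeK : cancel letter_code letter_decode.
Proof. by case; rewrite /letter_decode /= inordK. Qed.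

HB.instance Definition _ := Finite.copy letter (can_type letter_codeK).

(* The free monoid on the letters; its unit is the empty word. *)
Notation word := {fmonom letter}.

Definition calA : Type := {malg rat[word]}.

HB.instance Definition _ := GRing.Lalgebra.on calA.
HB.instance Definition _ :=
  GRing.Lalgebra_isAlgebra.Build rat calA (@malg_scalerAr word rat).

Definition e (l : letter) : calA := << fmu l >>.

Definition calA0 : set calA := [set w | exists (c d : rat) (p q r s : calA),
  w = c%:A + d *: e lz + e lz * p * e lz + e lz * q * e l0
      + e l1 * r * e lz + e l1 * s * e l0].

Definition tau_letter (l : letter) : calA :=
  match l with
  | l0 => e lz - e l1
  | l1 => e lz - e l0
  | lz => e lz
  end.

Definition tau_word (m : word) : calA := \prod_(l <- rev m) tau_letter l.

(* [tau_is_linear], [tau1], [tauM], [tau_e] and [tauK] below show that [tau] is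
   the anti-automorphism of the Q-algebra [calA] with the values [tau_letter]
   on the letters. *)
Definition tau (x : calA) : calA := \sum_(m <- msupp x) x@_m *: tau_word m.

Lemma tauEw (d : {fset word}) (x : calA) : (msupp x `<=` d)%fset ->
  tau x = \sum_(m <- d) x@_m *: tau_word m.
Proof.
move=> le; rewrite /tau (big_fset_incl _ le) // => m _ /mcoeff_outdom ->.
by rewrite scale0r.
Qed.

Lemma tau_is_linear : linear tau.
Proof.
move=> c x y; pose d := (msupp x `|` msupp y `|` msupp (c *: x + y))%fset.
have dx : (msupp x `<=` d)%fset.
  by rewrite /d -fsetUA; apply: fsubsetUl.
have dy : (msupp y `<=` d)%fset.
  by rewrite /d fsetUAC; apply: fsubsetUr.
have dxy : (msupp (c *: x + y) `<=` d)%fset by exact: fsubsetUr.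
rewrite (tauEw dx) (tauEw dy) (tauEw dxy) scaler_sumr -big_split /=.
by apply: eq_bigr => m _; rewrite mcoeffD mcoeffZ scalerDl scalerA.
Qed.

HB.instance Definition _ := GRing.isLinear.Build rat calA calA *:%R tau tau_is_linear.

Lemma tau_monom (m : word) : tau << m >> = tau_word m.
Proof.
by rewrite (@tauEw [fset m]%fset) ?msuppU_le // big_seq_fset1 mcoeffUU scale1r.
Qed.

Lemma tau1 : tau 1 = 1.
Proof.
have -> : 1 = << (mone : word) >> :> calA by [].
by rewrite tau_monom /tau_word fm1 /rev /= big_nil.
Qed.

Lemma tau_e (l : letter) : tau (e l) = tau_letter l.
Proof. by rewrite tau_monom /tau_word fmU /rev /= big_seq1. Qed.

Lemma tauZ (c : rat) (x : calA) : tau (c *: x) = c *: tau x.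
Proof. exact: linearZ. Qed.

Lemma tau_sum (r : seq word) (F : word -> calA) :
  tau (\sum_(m <- r) F m) = \sum_(m <- r) tau (F m).
Proof. exact: linear_sum. Qed.

Lemma tauD (x y : calA) : tau (x + y) = tau x + tau y.
Proof. exact: linearD. Qed.

Lemma tauM (x y : calA) : tau (x * y) = tau y * tau x.
Proof.
rewrite malg_mulE tau_sum [tau x]/tau mulr_sumr; apply: eq_bigr => m1 _.
rewrite tau_sum [tau y]/tau mulr_suml; apply: eq_bigr => m2 _.
rewrite malg_scaleM tauZ tau_monom mulrC; congr (_ *: _).
by rewrite /tau_word fmM rev_cat big_cat.
Qed.

Lemma tauK : involutive tau.
Proof.
have tau_letterK l : tau (tau_letter l) = e l.
  by case: l; rewrite /= ?raddfB /= !tau_e //; exact: subKr.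
have tau_wordK (s : seq letter) :
    tau (\prod_(l <- rev s) tau_letter l) = \prod_(l <- s) e l.
  elim: s => [|l s IHs]; first by rewrite /rev /= !big_nil tau1.
  by rewrite rev_cons -cats1 big_cat big_seq1 tauM tau_letterK IHs big_cons.
have monomE (s : seq letter) : \prod_(l <- s) e l = << FMonom s >>.
  elim: s => [|l s IHs]; first by rewrite big_nil -fmoneE.
  rewrite big_cons IHs /e malg_monomM.
  have -> // : mmul (fmu l) (FMonom s) = FMonom (l :: s).
  by apply: val_inj; rewrite /= fmM fmU.
move=> x; rewrite [in RHS](malg_sumE x) {2}/tau tau_sum.
by apply: eq_bigr => m _; rewrite tauZ tau_wordK monomE fmK.
Qed.

Lemma tau_calA0 (w : calA) : calA0 w -> calA0 (tau w).
Proof.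
have gen (T : lalgType rat) (f : T -> T) (x0 x1 xz : T) :
    {morph f : x y / x + y} -> (forall c, {morph f : x / c *: x}) -> f 1 = 1 ->
    (forall x y, f (x * y) = f y * f x) ->
    f x0 = xz - x1 -> f x1 = xz - x0 -> f xz = xz ->
  forall c d p q r s,
    f (c%:A + d *: xz + xz * p * xz + xz * q * x0 + x1 * r * xz + x1 * s * x0)
    = c%:A + d *: xz + xz * (f p + f q + f r + f s) * xz
      + xz * (- f r - f s) * x0 + x1 * (- f q - f s) * xz + x1 * f s * x0.
  move=> fD fZ f1 fM f0 fx1 fz c d p q r s.
  rewrite !fD !fZ f1 !fM f0 fx1 fz.
  rewrite !(mulrBr, mulrBl, mulrDr, mulrDl, mulrN, mulNr) opprB !mulrA !addrA.
  by rewrite [LHS](ACl (1*2*3*4*6*8*7*9*5*11*10)%AC).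
case=> c [d [p [q [r [s ->]]]]].
exists c, d, (tau p + tau q + tau r + tau s), (- tau r - tau s),
  (- tau q - tau s), (tau s).
exact: gen tauD tauZ tau1 tauM (tau_e l0) (tau_e l1) (tau_e lz) c d p q r s.
Qed.

Section tuple_lebesgue_measure.
Variable R : realType.
Local Notation rT := (measurableTypeR R).

Definition tcons n (p : rT * n.-tuple rT) : n.+1.-tuple rT :=
  [tuple of p.1 :: p.2].

Lemma measurable_tcons n : measurable_fun [set: rT * n.-tuple rT] (@tcons n).
Proof. exact: (measurable_cons measurable_fst measurable_snd). Qed.

HB.instance Definition _ n :=
  isMeasurableFun.Build _ _ _ _ (@tcons n) (@measurable_tcons n).

Section tcons_measure.
Variables (n : nat) (mu : {sigma_finite_measure set (n.-tuple rT) -> \bar R}).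

Definition tcons_measure : set (n.+1.-tuple rT) -> \bar R :=
  pushforward (@lebesgue_measure R \x mu)%E (@tcons n).

Let tcons_measure0 : tcons_measure set0 = 0%E.
Proof. exact: measure0. Qed.

Let tcons_measure_ge0 X : (0 <= tcons_measure X)%E.
Proof. exact: measure_ge0. Qed.

Let tcons_measure_sigma_additive : semi_sigma_additive tcons_measure.
Proof. exact: measure_semi_sigma_additive. Qed.

HB.instance Definition _ := isMeasure.Build _ _ _ tcons_measure
  tcons_measure0 tcons_measure_ge0 tcons_measure_sigma_additive.

Lemma tcons_measureE (X : set rT) (Y : set (n.-tuple rT)) :
    measurable X -> measurable Y ->
  tcons_measure [set t | X (thead t) /\ Y [tuple of behead t]] =
  (lebesgue_measure X * mu Y)%E.
Proof.
move=> mX mY; rewrite -product_measure1E // /tcons_measure /pushforward.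
congr (product_measure1 _ _ _); apply/funext => -[x t] /=.
have -> : [tuple of behead (tcons (x, t))] = t by apply: val_inj.
by rewrite theadE.
Qed.

Let tcons_measure_sigma_finite : sigma_finite setT tcons_measure.
Proof.
have /sigma_finiteP[F [FT ndF Foo]] := sigma_finiteT (@lebesgue_measure R).
have /sigma_finiteP[G [GT ndG Goo]] := sigma_finiteT mu.
pose H k := [set t : n.+1.-tuple rT | F k (thead t) /\ G k [tuple of behead t]].
exists H.
  apply/seteqP; split => // t _.
  have [i _ Fi] : (\bigcup_i F i) (thead t) by rewrite -FT.
  have [j _ Gj] : (\bigcup_j G j) [tuple of behead t] by rewrite -GT.
  exists (maxn i j) => //; split.
    exact: (subsetPset _ _ (ndF _ _ (leq_maxl i j))).
  exact: (subsetPset _ _ (ndG _ _ (leq_maxr i j))).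
move=> k; have [mF Fk] := Foo k; have [mG Gk] := Goo k; split; last first.
  by rewrite tcons_measureE // lte_mul_pinfty// ge0_fin_numE.
apply: measurableI.
  have := measurable_tnth (T := rT) (@ord0 n).
  by move=> /(_ measurableT _ mF); rewrite setTI.
have := @measurable_behead _ rT n.
by move=> /(_ measurableT _ mG); rewrite setTI.
Qed.

HB.instance Definition _ := Measure_isSigmaFinite.Build _ _ _ tcons_measure
  tcons_measure_sigma_finite.

End tcons_measure.

(* The n-fold product of the Lebesgue measure; the library has product measures
   on pairs only. See [lebesgue_tuple_box]. *)
Fixpoint lebesgue_tuple n : {sigma_finite_measure set (n.-tuple rT) -> \bar R} :=
  match n with
  | 0 => \d_([tuple])
  | m.+1 => tcons_measure (lebesgue_tuple m)
  end.

Lemma lebesgue_tuple_box n (X : 'I_n -> set rT) :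
    (forall i, measurable (X i)) ->
  lebesgue_tuple n [set t | forall i, X i (tnth t i)] =
  (\big[*%E/1]_(i < n) lebesgue_measure (X i))%E.
Proof.
elim: n X => [|n IHn] X mX.
  by rewrite big_ord0 /= diracE mem_set // => -[].
rewrite big_ord_recl -IHn => [|i]; last exact: mX.
rewrite -tcons_measureE //=; last first.
  rewrite (_ : mkset _ = \bigcap_(i in [set: 'I_n])
      (@tnth n rT ^~ i @^-1` X (lift ord0 i))); last first.
    by apply/seteqP; split => [t Xt i _|t Xt i]; exact: Xt.
  apply: fin_bigcap_measurable => // i _.
  by rewrite -[Y in measurable Y]setTI; exact: measurable_tnth.
have tnth_behead (t : n.+1.-tuple rT) i :
    tnth t (lift ord0 i) = tnth [tuple of behead t] i.
  by rewrite [in LHS](tuple_eta t) tnthS.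
congr (tcons_measure _ _); apply/seteqP; split=> t /=.
  by move=> Xt; split => [|i]; [exact: Xt|rewrite -tnth_behead; exact: Xt].
move=> [X0 XS] i; case: (unliftP ord0 i) => [j|] -> //.
by rewrite tnth_behead; exact: XS.
Qed.

End tuple_lebesgue_measure.

Section iterated_integral.
Variable R : realType.

(* The library integrates real-valued functions only. *)
Definition cintegral d (T : measurableType d) (mu : {measure set T -> \bar R})
    (D : set T) (f : T -> R[i]) : R[i] :=
  (\int[mu]_(x in D) complex.Re (f x) +i* \int[mu]_(x in D) complex.Im (f x))%C.

(* 0 < t_1 < ... < t_n < 1 *)
Definition simplex n : set (n.-tuple (measurableTypeR R)) :=
  [set t | path <%R 0 (rcons t 1)].

(* I(0; a_1, ..., a_n; 1) *)
Definition iterated_integral n (a : n.-tuple R[i]) : R[i] :=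
  cintegral (lebesgue_tuple R n) (@simplex n)
    (fun t => \prod_(i < n) ((tnth t i)%:C - tnth a i)^-1)%C.

Lemma iterated_integral0 (a : 0.-tuple R[i]) : iterated_integral a = 1.
Proof.
have D0 : @simplex 0 = setT.
  apply/seteqP; split => // t _; by rewrite /simplex /= tuple0 /= ltr01.
have mD : measurable (@simplex 0) by rewrite D0.
have muD : lebesgue_tuple R 0 (@simplex 0) = 1%E.
  by rewrite D0 /= diracE mem_set.
have E (f : 0.-tuple (measurableTypeR R) -> R) r : (forall t, f t = r) ->
    \int[lebesgue_tuple R 0]_(t in @simplex 0) f t = r.
  move=> fr; under eq_Rintegral do rewrite fr.
  by rewrite Rintegral_cst // [X in fine X]muD mulr1.
rewrite /iterated_integral /cintegral (E _ 1) ?(E _ 0) // => t;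
  by rewrite big_ord0.
Qed.

Definition point (z : R[i]) (l : letter) : R[i] :=
  match l with l0 => 0 | l1 => 1 | lz => z end.

Definition L_word (z : R[i]) (m : word) : R[i] :=
  iterated_integral (map_tuple (point z) (in_tuple m)).

(* [L z] is meaningful on [calA0] only: non-convergent words contribute junk
   values. *)
Definition L (z : R[i]) (w : calA) : R[i] :=
  \sum_(m <- msupp w) ratr w@_m * L_word z m.

Lemma L_monom (z : R[i]) (m : word) : L z << m >> = L_word z m.
Proof.
by rewrite /L msuppU oner_eq0 big_seq_fset1 mcoeffUU rmorph1 mul1r.
Qed.

Lemma L1 (z : R[i]) : L z 1 = 1.
Proof.
have -> : 1 = << mone >> :> calA by [].
rewrite L_monom /L_word.
move: (map_tuple _ _); rewrite fm1 => a; exact: iterated_integral0.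
Qed.

End iterated_integral.

(* Main.v *)
From HB Require Import structures.
Require Import Defs.
From mathcomp Require Import all_boot all_order all_algebra.
From mathcomp Require Import finmap monalg ring lra.
From mathcomp Require Import complex.
From mathcomp Require Import all_classical all_reals all_analysis measurable_realfun.

Set Implicit Arguments.
Unset Strict Implicit.
Unset Printing Implicit Defensive.

Import Order.TTheory GRing.Theory Num.Theory.
Import numFieldNormedType.Exports.

Local Open Scope classical_set_scope.
Local Open Scope ring_scope.

(** The Moebius transformation phi(t) = z(1-t)/(z-t) is an involution that
    exchanges 0 with 1 and z with infinity.  It pulls dlog t, dlog (t-1) and
    dlog (t-z) back to dlog (t-1) - dlog (t-z), dlog t - dlog (t-z) and
    - dlog (t-z): up to sign, to the forms of tau(e_0), tau(e_1), tau(e_z).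
    The substitution t_i = phi(s_(n+1-i)) therefore turns the iterated integral
    of a word into that of its image under tau; the order of the letters is
    reversed because phi is decreasing, and the signs cancel against those of
    the n orientation reversals.

    For real z > 1 this is literally a proof.  Then phi maps ]0,1[ onto itself,
    and each of the six forms involved has constant sign on ]0,1[, so that
    Tonelli's theorem and a change of variables for nonnegative measurable
    functions ([ge0_substitution]) justify every step; the outcome is
    [word_integral_real_duality].

    For other z the arc phi([0,1]) leaves the segment, and the identity is
    continued analytically.  The map s |-> z = (1+s)^2/(4s) sends the punctured
    open unit disc onto the complement of [0,1], and the interval ]0,1[ to real
    z > 1.  In the variable s,
      1/(t-z) = -4s / ((1 - u s)(1 - conj(u) s)),
      u = 2t - 1 + 2i sqrt(t(1-t)),   |u| = 1 for t in [0,1].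
    Hence the integrand of a word is a power series in s whose n-th coefficient
    is at most (n+1)^m times a function of t that is integrable on the simplex,
    and each word integral is itself a power series in s that converges on the
    whole disc ([expansion_word_integral]).  The difference of the two sides
    vanishes for 0 < s < 1, so all its coefficients vanish ([expansion_eq0]),
    and it is zero for every z outside [0,1].

    Absolute convergence is needed to expand tau of a word multilinearly and to
    integrate power series term by term.  It follows from one explicit estimate
    with the weight t^(-1/2) - 1 ([upper_iter_majorant_lty]).  *)

(** * Change of variables for nonnegative measurable functions *)

Section measurability.
Variable R : realType.
Local Notation rT := (measurableTypeR R).

Lemma measurable_funV d (T : measurableType d) (D : set T) (f : T -> rT) :
  measurable_fun D f -> measurable_fun D (fun t => (f t)^-1 : rT).
Proof.
move=> mf.
(* The real power is measurable, but it inverts positive reals only. *)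
have -> : (fun t => (f t)^-1) = (fun t => f t * ((f t) ^+ 2) `^ (-1)).
  apply/funext => t; have [->|f0] := eqVneq (f t) 0; first by rewrite invr0 mul0r.
  by rewrite powR_inv1 ?sqr_ge0// expr2 invfM mulrA divff// mul1r.
apply: measurable_funM => //.
apply: (measurableT_comp (measurable_powR _)).
exact: measurable_funX.
Qed.

End measurability.

Section substitution.
Variable R : realType.
Local Notation rT := (measurableTypeR R).
Local Notation mu := (@lebesgue_measure R).
Variables (phi k : rT -> rT).
Hypotheses (mphi : measurable_fun setT phi) (mk : measurable_fun setT k).
Hypothesis k0 : forall s, 0 <= k s.
Hypothesis tail : forall a,
  (\int[mu]_s ((\1_(`]a, +oo[) (phi s))%:E * (k s)%:E))%E =
  mu (`]0%R, 1%R[ `&` `]a, +oo[).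
Hypothesis phi01 : forall s, k s != 0 -> 0 < phi s < 1.

(** A density against Lebesgue measure becomes a plain push-forward in the
    plane: [U] is the region under the graph of [k], and [Phi] sends the rest of
    the plane to the point 2, outside ]0,1[.  *)
Let U (p : rT * rT) := (0 <= p.2) && (p.2 < k p.1).
Let Phi (p : rT * rT) : rT := if U p then phi p.1 else 2.

Let mU : measurable_fun setT U.
Proof.
rewrite /U; apply: measurable_and.
  apply: measurable_fun_ler => //; exact: measurable_snd.
by apply: measurable_fun_ltr; [exact: measurable_snd|apply: measurableT_comp].
Qed.

Let mPhi : measurable_fun setT Phi.
Proof.
rewrite /Phi; apply: measurable_fun_ifT => //.
by apply: measurableT_comp => //; exact: measurable_fst.
Qed.

Let PhiE (G : rT -> \bar R) : measurable_fun setT G -> (forall t, (0 <= G t)%E) ->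
  (\int[(mu \x mu)%E]_(p in Phi @^-1` `]0%R, 1%R[) (G (Phi p)) =
   \int[mu]_s (G (phi s) * (k s)%:E))%E.
Proof.
move=> mG G0.
have mP : measurable (Phi @^-1` `]0%R, 1%R[).
  by rewrite -[X in measurable X]setTI; apply: mPhi => //; exact: measurable_itv.
rewrite integral_mkcond fubini_tonelli1 /fubini_F; last 2 first.
- apply/(measurable_restrictT _ _).1 => //; apply: measurable_funTS.
  exact: measurableT_comp.
- by move=> p; apply: erestrict_ge0.
apply: eq_integral => s _.
transitivity (\int[mu]_(y in `[0%R, k s[) (G (phi s)))%E.
  rewrite [RHS]integral_mkcond; apply: eq_integral => y _.
  rewrite /patch /=.
  have -> : ((s, y) \in Phi @^-1` `]0%R, 1%R[) = (y \in `[0%R, k s[%classic).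
    apply/idP/idP; rewrite !inE /= !in_itv/= /Phi /U /=.
      by case: ifPn => // _ /andP[_]; rewrite (@ltr_nat R 2 1).
    move=> yk; rewrite yk phi01 // gt_eqF //.
    by case/andP: yk => y0; exact: le_lt_trans.
  case: ifPn => //; rewrite !inE /= in_itv /Phi /U/= => -> //.
rewrite integral_cst//= lebesgue_measure_itv/= lte_fin.
case: ifPn; rewrite ?sube0//.
by rewrite -leNgt => ks; have -> : k s = 0 by apply/eqP; rewrite eq_le ks k0.
Qed.

(** The hypothesis [tail] says that the push-forward of [k(s) ds] by [phi] and
    Lebesgue measure on ]0,1[ agree on half-lines; half-lines generate the Borel
    sets, so the two measures agree, and so do the integrals of every
    nonnegative measurable function.  No continuity of [G] is involved, which
    matters because [G] will blow up at the end points.  *)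
Lemma ge0_substitution (G : rT -> \bar R) :
  measurable_fun setT G -> (forall t, (0 <= G t)%E) ->
  (\int[mu]_(t in `]0%R, 1%R[) G t = \int[mu]_s (G (phi s) * (k s)%:E))%E.
Proof.
move=> mG G0; rewrite -PhiE //.
rewrite -[RHS](@ge0_integral_pushforward _ _ _ _ R Phi mPhi (mu \x mu)%E) //; last first.
  exact: measurable_funTS.
apply: eq_measure_integral => A mA A01.
have mI : measurable (`]0%R, 1%R[%classic : set rT) by exact: measurable_itv.
have mP : measurable (Phi @^-1` `]0%R, 1%R[).
  by rewrite -[X in measurable X]setTI; apply: mPhi => //; exact: measurable_itv.
have key : mrestr mu mI A = mrestr (pushforward (mu \x mu)%E Phi) mI A.
  pose m1 : {measure set rT -> \bar R} := mrestr mu mI.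
  pose m2 : {measure set rT -> \bar R} :=
    mrestr (pushforward (mu \x mu)%E Phi) mI.
  have H := @RGenOInfty.measurableE R.
  change (m1 A = m2 mPhi A).
  apply: (@measure_unique _ R rT (@RGenOInfty.G R)
    (fun n => `]- n%:R, +oo[%classic) H _ _ _ m1 (m2 mPhi)) => //.
  - move=> _ _ [a ->] [b ->]; exists (Num.max a b).
    by rewrite predeqE => y; rewrite /= !in_itv/= !andbT gt_max; split => [[-> ->]|/andP[]].
  - by move=> i; exists (- i%:R).
  - apply/seteqP; split => // y _; exists (Num.truncn `|y|).+1 => //=.
    rewrite in_itv/= andbT ltrNl; apply: le_lt_trans (ler_norm _) _.
    by rewrite normrN truncnS_gt.
  - move=> _ [a ->]; rewrite /m1 /m2 /= /mrestr setIC -tail.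
    rewrite -(@PhiE (fun t => (\1_(`]a, +oo[) t)%:E)); last 2 first.
    + apply/measurable_EFinP; apply: measurable_indic; exact: measurable_itv.
    + by move=> t; rewrite lee_fin.
    rewrite (integral_indic (mu \x mu)%E mP (A := Phi @^-1` `]a, +oo[)).
      by rewrite /pushforward setIC.
    by rewrite -[X in measurable X]setTI; apply: mPhi => //; exact: measurable_itv.
  - move=> n; rewrite /m1 /= /mrestr; apply: (@le_lt_trans _ _ (mu `]0%R, 1%R[)).
      by apply: le_measure; rewrite ?inE//; apply: measurableI.
    by rewrite lebesgue_measure_itv/= lte_fin ltr01 -EFinB ltry.
by move: key; rewrite /mrestr setIidl.
Qed.
End substitution.

(** * Iterated integrals of nonnegative functions *)

Section iterated.
Variable R : realType.
Local Notation rT := (measurableTypeR R).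
Local Notation mu := (@lebesgue_measure R).
Implicit Types h f g : nat -> rT -> rT.

(** [upper_iter h n k x] is the integral of
    h_k(t_1) h_(k+1)(t_2) ... h_(k+n-1)(t_n) over x < t_1 < ... < t_n, and
    [lower_iter h n x] that of h_0(t_1) ... h_(n-1)(t_n) over
    t_1 < ... < t_n < x.  The first recursion integrates the smallest variable
    last, the second the largest one.  *)
Fixpoint upper_iter h (n k : nat) (x : rT) : \bar R :=
  if n is n'.+1 then
    (\int[mu]_t (((x < t)%R%:R * h k t)%:E * upper_iter h n' k.+1 t))%E
  else 1%E.

Fixpoint lower_iter h (n : nat) (x : rT) : \bar R :=
  if n is n'.+1 then
    (\int[mu]_t (((t < x)%R%:R * h n' t)%:E * lower_iter h n' t))%E
  else 1%E.

Lemma measurable_lt_indic d (T : measurableType d) (f g : T -> rT) :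
  measurable_fun setT f -> measurable_fun setT g ->
  measurable_fun setT (fun p => (f p < g p)%R%:R : rT).
Proof.
move=> mf mg; rewrite [X in measurable_fun _ X](_ : _ =
  \1_[set p | f p < g p]); last by apply/funext => p; rewrite indicE mem_setE.
apply: measurable_indic.
rewrite -[X in measurable X]setTI.
by have := measurable_fun_ltr mf mg; apply; rewrite // ?set_true.
Qed.

Section theory.
Variable h : nat -> rT -> rT.
Hypotheses (mh : forall i, measurable_fun setT (h i)) (h0 : forall i t, 0 <= h i t).

Lemma upper_iter_ge0 n k x : (0 <= upper_iter h n k x)%E.
Proof.
elim: n k x => [|n IH] k x //=; apply: integral_ge0 => t _.
by rewrite mule_ge0// lee_fin mulr_ge0.
Qed.

Lemma lower_iter_ge0 n x : (0 <= lower_iter h n x)%E.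
Proof.
elim: n x => [|n IH] x //=; apply: integral_ge0 => t _.
by rewrite mule_ge0// lee_fin mulr_ge0.
Qed.

Lemma measurable_upper_iter n k : measurable_fun setT (upper_iter h n k).
Proof.
elim: n k => [|n IH] k /=; first exact: measurable_cst.
apply: (measurable_fun_fubini_tonelli_F (m2 := mu)
  (fun p : rT * rT => ((p.1 < p.2)%R%:R * h k p.2)%:E * upper_iter h n k.+1 p.2)%E).
  apply: emeasurable_funM.
    apply/measurable_EFinP; apply: measurable_funM.
      by apply: measurable_lt_indic.
    exact: (measurableT_comp (mh k)).
  exact: (measurableT_comp (IH k.+1)).
by move=> p; rewrite mule_ge0 ?upper_iter_ge0// lee_fin mulr_ge0.
Qed.

Lemma measurable_lower_iter n : measurable_fun setT (lower_iter h n).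
Proof.
elim: n => [|n IH] /=; first exact: measurable_cst.
apply: (measurable_fun_fubini_tonelli_F (m2 := mu)
  (fun p : rT * rT => ((p.2 < p.1)%R%:R * h n p.2)%:E * lower_iter h n p.2)%E).
  apply: emeasurable_funM.
    apply/measurable_EFinP; apply: measurable_funM.
      by apply: measurable_lt_indic.
    exact: (measurableT_comp (mh n)).
  exact: (measurableT_comp IH).
by move=> p; rewrite mule_ge0 ?lower_iter_ge0// lee_fin mulr_ge0.
Qed.

(** Both sides are the integral over the whole simplex.  Singling out the i-th
    variable t splits it as K i, the integral of (variables below t) * h_i(t) *
    (variables above t), and Tonelli's theorem moves the distinguished variable
    one step up: K i = K (i+1).  *)
Lemma upper_iterE_lower_iter n : (forall i t, h i t != 0 -> 0 < t < 1) ->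
  upper_iter h n 0 0 = lower_iter h n 1.
Proof.
case: n => [//|n] hsupp.
(* The i-th variable is singled out. *)
pose K i := (\int[mu]_t (lower_iter h i t * (h i t)%:E * upper_iter h (n - i) i.+1 t))%E.
have KS i : (i < n)%N -> K i = K i.+1.
  move=> lin; rewrite /K (_ : n - i = (n - i.+1).+1)%N /=; last by rewrite subnSK.
  pose F (p : rT * rT) := (lower_iter h i p.1 * (h i p.1)%:E *
    (((p.1 < p.2)%R%:R * h i.+1 p.2)%:E * upper_iter h (n - i.+1) i.+2 p.2))%E.
  have mF : measurable_fun setT F.
    apply: emeasurable_funM; apply: emeasurable_funM.
    - exact: (measurableT_comp (measurable_lower_iter _)).
    - by apply/measurable_EFinP; apply: (measurableT_comp (mh _)).
    - apply/measurable_EFinP; apply: measurable_funM.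
        exact: measurable_lt_indic.
      exact: (measurableT_comp (mh _)).
    - exact: (measurableT_comp (measurable_upper_iter _ _)).
  have F0 p : (0 <= F p)%E.
    rewrite /F !mule_ge0 ?lower_iter_ge0 ?upper_iter_ge0 ?lee_fin//.
    by rewrite mulr_ge0.
  transitivity (\int[mu]_t \int[mu]_u F (t, u))%E.
    apply: eq_integral => t _; rewrite /F /= ge0_integralZl//.
    - apply: emeasurable_funM; last exact: measurable_upper_iter.
      apply/measurable_EFinP; apply: measurable_funM; last exact: mh.
      exact: measurable_lt_indic.
    - by move=> u _; rewrite mule_ge0 ?upper_iter_ge0// lee_fin mulr_ge0.
    - by rewrite mule_ge0 ?lower_iter_ge0// lee_fin.
  rewrite fubini_tonelli//; apply: eq_integral => u _.
  transitivity (\int[mu]_t (((h i.+1 u)%:E * upper_iter h (n - i.+1) i.+2 u) *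
      (((t < u)%R%:R * h i t)%:E * lower_iter h i t)))%E.
    apply: eq_integral => t _; rewrite /F /= !EFinM.
    by rewrite [RHS](AC (2*(2*1))%AC ((5*4)*((3*1)*2))%AC).
  rewrite ge0_integralZl//.
  - by rewrite muleC muleA.
  - apply: emeasurable_funM; last exact: measurable_lower_iter.
    apply/measurable_EFinP; apply: measurable_funM; last exact: mh.
    exact: measurable_lt_indic.
  - by move=> t _; rewrite mule_ge0 ?lower_iter_ge0// lee_fin mulr_ge0.
  - by rewrite mule_ge0 ?upper_iter_ge0// lee_fin.
have K0n : K 0%N = K n.
  have: (n <= n)%N by [].
  elim: {-2}n => [//|i IH] lin; rewrite IH; first exact: KS.
  exact: ltnW.
transitivity (K 0%N).
  rewrite /K subn0 /=; apply: eq_integral => t _; rewrite mul1e.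
  have [->|/hsupp/andP[-> _]] := eqVneq (h 0%N t) 0; last by rewrite mul1r.
  by rewrite mulr0.
rewrite K0n /K subnn /=; apply: eq_integral => t _; rewrite mule1 muleC.
have [->|/hsupp/andP[_ ->]] := eqVneq (h n t) 0; last by rewrite mul1r.
by rewrite mulr0.
Qed.

End theory.

Section mobius.
Variables (phi k : rT -> rT).
Hypotheses (mphi : measurable_fun setT phi) (mk : measurable_fun setT k).
Hypothesis k0 : forall s, 0 <= k s.
Hypothesis tail : forall a,
  (\int[mu]_s ((\1_(`]a, +oo[) (phi s))%:E * (k s)%:E))%E =
  mu (`]0%R, 1%R[ `&` `]a, +oo[).
Hypothesis phi01 : forall s, k s != 0 -> 0 < phi s < 1.
Hypothesis phi_anti : forall x s, 0 <= x <= 1 -> k s != 0 ->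
  (phi x < phi s) = (s < x).
Hypothesis ksupp : forall s, k s != 0 -> 0 < s < 1.

Variable f : nat -> rT -> rT.
Hypotheses (mf : forall i, measurable_fun setT (f i)) (f0 : forall i t, 0 <= f i t).
Hypothesis fsupp : forall i t, f i t != 0 -> 0 < t < 1.

(** A decreasing substitution exchanges integration above [phi x] with
    integration below [x], so it reverses the order of the integrands.  *)
Lemma upper_iter_substitution n i x : 0 <= x <= 1 ->
  upper_iter f n i (phi x) =
  lower_iter (fun j s => f (i + n - j.+1)%N (phi s) * k s) n x.
Proof.
elim: n i x => [//|n IH] i x x01 /=.
rewrite [LHS](_ : _ = \int[mu]_(t in `]0%R, 1%R[)
   (((phi x < t)%R%:R * f i t)%:E * upper_iter f n i.+1 t))%E; last first.
  rewrite [RHS]integral_mkcond; apply: eq_integral => t _; rewrite /patch.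
  case: ifPn => //; rewrite notin_setE /= in_itv/= => /negP t01.
  have [->|/fsupp] := eqVneq (f i t) 0; first by rewrite mulr0 mul0e.
  by rewrite (negbTE t01).
rewrite (ge0_substitution mphi mk k0 tail phi01).
- apply: eq_integral => s _.
  have [->|ks] := eqVneq (k s) 0; first by rewrite mule0 !mulr0 mul0e.
  rewrite IH; last by have /andP[/ltW -> /ltW ->] := ksupp ks.
  by rewrite phi_anti// addSnnS addnK muleAC -EFinM mulrA.
- apply: emeasurable_funM; last exact: measurable_upper_iter.
  apply/measurable_EFinP; apply: measurable_funM; last exact: mf.
  exact: measurable_lt_indic.
- by move=> t; rewrite mule_ge0 ?upper_iter_ge0// lee_fin mulr_ge0.
Qed.

Lemma upper_iter_duality n : phi 1 = 0 ->
  upper_iter f n 0 0 =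
  upper_iter (fun j s => f (n - j.+1)%N (phi s) * k s) n 0 0.
Proof.
move=> phi1; rewrite -{1}phi1 upper_iter_substitution ?ler01 ?lexx//.
rewrite upper_iterE_lower_iter//.
- move=> i; apply: measurable_funM => //.
  by apply: (measurableT_comp (mf _)).
- by move=> i t; rewrite mulr_ge0.
- by move=> i t; have [->|/ksupp//] := eqVneq (k t) 0; rewrite mulr0 eqxx.
Qed.

End mobius.

End iterated.

(** * Integrals over the simplex *)

Section simplex.
Variable R : realType.
Local Notation rT := (measurableTypeR R).
Local Notation mu := (@lebesgue_measure R).
Implicit Types h : nat -> rT -> rT.

(** The lower end point has to vary for an induction that peels off the
    smallest variable; [simplex n] is the case [x = 0].  *)
Definition simplex_above n (x : rT) : set (n.-tuple rT) :=
  [set t | path <%R x (rcons t 1)].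
Arguments simplex_above n x : clear implicits.

Lemma in_simplex_above n x (t : n.-tuple rT) :
  (t \in simplex_above n x) = path <%R x (rcons t 1).
Proof. by apply/idP/idP; rewrite inE. Qed.

Lemma measurable_nth_tuple n (x0 : rT) i :
  measurable_fun setT (fun t : n.-tuple rT => nth x0 t i : rT).
Proof.
have [lin|nlei] := ltnP i n.
  rewrite (_ : (fun _ => _) = (fun t : n.-tuple rT => tnth t (Ordinal lin))).
    exact: measurable_tnth.
  by apply/funext => t; rewrite (tnth_nth x0).
rewrite (_ : (fun _ => _) = cst x0); first exact: measurable_cst.
by apply/funext => t; rewrite nth_default ?size_tuple.
Qed.

Lemma measurable_simplex n (x : rT) :
  measurable (simplex_above n x).
Proof.
rewrite (_ : simplex_above _ _ = \bigcap_(i in `I_n.+1)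
  [set t : n.-tuple rT | nth 0 (x :: rcons t 1) i < nth 0 (rcons t 1) i]).
  apply: fin_bigcap_measurable => // i /= lin.
  have mn j : measurable_fun setT (fun t : n.-tuple rT => nth 0 (rcons t 1) j : rT).
    rewrite (_ : (fun _ => _) = (fun t : n.-tuple rT => if (j < n)%N then nth 0 t j
      else if j == n then 1 else 0)).
      by case: ltnP => _; [exact: measurable_nth_tuple|exact: measurable_cst].
    by apply/funext => t; rewrite nth_rcons size_tuple.
  have mn' : measurable_fun setT (fun t : n.-tuple rT => nth 0 (x :: rcons t 1) i : rT).
    by case: i lin => [|i] _ /=; [exact: measurable_cst|exact: mn].
  rewrite -[X in measurable X]setTI.
  by have := measurable_fun_ltr mn' (mn i); apply.
apply/seteqP; split => t /=.
  move=> /(pathP 0) H i lin; apply: H.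
  by rewrite size_rcons size_tuple.
move=> H; apply/(pathP 0) => i; rewrite size_rcons size_tuple => lin.
exact: H.
Qed.

Lemma measurable_prod_tuple n h : (forall i, measurable_fun setT (h i)) ->
  measurable_fun setT (fun t : n.-tuple rT => \prod_(i < n) h i (tnth t i) : rT).
Proof.
move=> mh; apply: measurable_prod => i _.
apply: (measurableT_comp (mh _)); exact: measurable_tnth.
Qed.

Lemma integral_simplex h n k x :
  (forall i, measurable_fun setT (h i)) -> (forall i t, 0 <= h i t) ->
  (forall i t, h i t != 0 -> 0 < t < 1) -> x < 1 ->
  (\int[lebesgue_tuple R n]_(t in simplex_above n x)
     (\prod_(i < n) h (k + i)%N (tnth t i))%:E)%E = upper_iter h n k x.
Proof.
move=> mh h0 hsupp; elim: n k x => [|n IH] k x x1.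
  rewrite (_ : simplex_above _ _ = setT); last first.
    by apply/seteqP; split => // t _ /=; rewrite /simplex_above /= tuple0 /= x1.
  rewrite (eq_integral (cst 1%E)) => [|t _]; last by rewrite big_ord0.
  by rewrite integral_cst//= mul1e diracE mem_set.
rewrite integral_mkcond /=.
pose F := (fun t : n.+1.-tuple rT => (\prod_(i < n.+1) h (k + i)%N (tnth t i))%:E)
  \_ (simplex_above n.+1 x).
have mF : measurable_fun setT F.
  apply/(measurable_restrictT _ _).1; first exact: measurable_simplex.
  apply: measurable_funTS; apply/measurable_EFinP.
  exact: (@measurable_prod_tuple _ (fun i => h (k + i)%N)).
have F0 t : (0 <= F t)%E.
  by apply: erestrict_ge0 => s _; rewrite lee_fin prodr_ge0.
rewrite -/F /tcons_measure ge0_integral_pushforward// preimage_setT.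
rewrite fubini_tonelli1; last 2 first.
- by apply: (measurableT_comp mF); exact: measurable_tcons.
- by move=> p; exact: F0.
apply: eq_integral => t _; rewrite /fubini_F/=.
have [ht|ht] := eqVneq (h k t) 0.
  rewrite ht mulr0 mul0e integral0_eq// => s _.
  rewrite /F /patch; case: ifP => // _.
  by rewrite big_ord_recl tnth0 addn0 ht mul0r.
have /andP[_ t1] := hsupp _ _ ht.
rewrite -IH// [X in _ = (_ * X)%E]integral_mkcond -ge0_integralZl//; last first.
- by rewrite lee_fin mulr_ge0.
- by move=> s _; apply: erestrict_ge0 => {}s _; rewrite lee_fin prodr_ge0.
- apply/(measurable_restrictT _ _).1; first exact: measurable_simplex.
  apply: measurable_funTS; apply/measurable_EFinP.
  exact: (@measurable_prod_tuple _ (fun i => h (k.+1 + i)%N)).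
apply: eq_integral => s _; rewrite /F /patch.
rewrite !in_simplex_above /=.
case: (ltP x t) => xt /=; last by rewrite mul0r mul0e.
case: ifP => _; last by rewrite mule0.
rewrite big_ord_recl tnth0 addn0 mul1r EFinM; congr (_ * (_)%:E)%E.
by apply: eq_bigr => i _; rewrite tnthS addSnnS.
Qed.

End simplex.

(** * The Moebius involution *)

Section ftc.
Variable R : realType.
Local Notation rT := (measurableTypeR R).
Local Notation mu := (@lebesgue_measure R).

Lemma integral_derive (F f : R -> R) (a b : R) : a < b ->
  (forall t : R, a <= t <= b -> is_derive t 1 F (f t)) ->
  (forall t : R, a <= t <= b -> {for t, continuous f}) ->
  (\int[mu]_(t in `[a, b]) (f t)%:E = (F b - F a)%:E)%E.
Proof.
move=> ab dF cf; rewrite EFinB.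
have cF t : a <= t <= b -> {for t, continuous F}.
  move=> /dF dFt; apply: differentiable_continuous.
  by apply/derivable1_diffP; case: dFt.
apply: continuous_FTC2 => //.
- apply: continuous_in_subspaceT => t /[!inE]/=; rewrite in_itv/= => tab.
  exact: cf.
- split.
  + move=> t; rewrite in_itv/= => /andP[/ltW ? /ltW ?].
    by have [] : is_derive t 1 F (f t) by apply: dF; apply/andP.
  + by apply: cvg_at_right_filter; apply: cF; rewrite lexx ltW.
  + by apply: cvg_at_left_filter; apply: cF; rewrite lexx ltW.
- move=> t; rewrite in_itv/= => /andP[/ltW ? /ltW ?].
  have dFt : is_derive t 1 F (f t) by apply: dF; apply/andP.
  by rewrite derive1E derive_val.
Qed.

End ftc.

Section mobius_form.
Variable R : realType.
Local Notation rT := (measurableTypeR R).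
Local Notation mu := (@lebesgue_measure R).
Variable x : R.
Hypothesis x1 : 1 < x.

Definition mobius (s : R) : R := x * (1 - s) / (x - s).

Definition mobius_deriv (s : R) : R := x * (x - 1) / (x - s) ^+ 2.

Definition on01 (f : R -> R) (s : R) : R := if 0 < s < 1 then f s else 0.

Lemma mobiusK s : s <> x -> mobius (mobius s) = s.
Proof.
have lt1x := x1.
move=> sx; rewrite /mobius.
have ? : x - s != 0 by rewrite subr_eq0; apply/eqP => /esym.
have ? : x != 0 by rewrite gt_eqF// (lt_trans ltr01).
have ? : x - 1 != 0 by rewrite subr_eq0 gt_eqF.
have E : x - x * (1 - s) / (x - s) = x * (x - 1) / (x - s) by field.
have ? : x - x * (1 - s) / (x - s) != 0.
  by rewrite E !mulf_neq0 ?invr_eq0.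
rewrite E; field; do ?[apply/andP; split]; lra.
Qed.

Lemma mobius_anti s t : s < x -> t < x -> (mobius s < mobius t) = (t < s).
Proof.
have lt1x := x1.
move=> sx tx; rewrite /mobius -subr_gt0.
have -> : x * (1 - t) / (x - t) - x * (1 - s) / (x - s) =
    (s - t) * (x * (x - 1) / ((x - t) * (x - s))).
  by field; apply/andP; split; lra.
by rewrite pmulr_lgt0 ?subr_gt0//; apply: divr_gt0; apply: mulr_gt0; lra.
Qed.

Lemma mobius0 : mobius 0 = 1.
Proof.
have lt1x := x1.
rewrite /mobius; field; lra. Qed.

Lemma mobius1 : mobius 1 = 0.
Proof. by rewrite /mobius subrr mulr0 mul0r. Qed.

Lemma mobius01 s : 0 < s < 1 -> 0 < mobius s < 1.
Proof.
have lt1x := x1.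
move=> /andP[s0 s1]; apply/andP; split.
  by rewrite -mobius1 mobius_anti; lra.
by rewrite -mobius0 mobius_anti; lra.
Qed.

Lemma measurable_on01 (f : rT -> rT) :
  measurable_fun setT f -> measurable_fun setT (on01 f : rT -> rT).
Proof.
move=> mf; apply: measurable_fun_ifT => //; first apply: measurable_and.
by apply: measurable_fun_ltr.
by apply: measurable_fun_ltr.
Qed.

Lemma measurable_mobius : measurable_fun setT (mobius : rT -> rT).
Proof.
apply: measurable_funM.
  by apply: measurable_funM => //; apply: measurable_funB.
by apply: measurable_funV; apply: measurable_funB.
Qed.

Lemma measurable_mobius_deriv : measurable_fun setT (mobius_deriv : rT -> rT).
Proof.
apply: measurable_funM => //; apply: measurable_funV.
by apply: measurable_funX; apply: measurable_funB.
Qed.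

Lemma on01_mobius_deriv_ge0 s : 0 <= on01 mobius_deriv s.
Proof.
have lt1x := x1.
rewrite /on01; case: ifP => // _; rewrite divr_ge0 ?sqr_ge0// mulr_ge0//; lra.
Qed.

Lemma on01_supp f s : on01 f s != 0 -> 0 < s < 1.
Proof. by rewrite /on01; case: ifP => //; rewrite eqxx. Qed.

Lemma is_derive_mobius (s : R) : s < x ->
  is_derive s 1 (fun s => - mobius s) (mobius_deriv s).
Proof.
have lt1x := x1.
move=> sx; have xs : x - s != 0 by lra.
rewrite /mobius; apply: is_derive_eq.
rewrite /mobius_deriv /GRing.scale /=; field; lra.
Qed.

Lemma integral_mobius_deriv c : 0 <= c < 1 ->
  (\int[mu]_(s in `]0%R, mobius c[) (mobius_deriv s)%:E = (1 - c)%:E)%E.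
Proof.
have lt1x := x1.
move=> /andP[c0 c1].
have b0 : 0 < mobius c by rewrite -mobius1 mobius_anti; lra.
have b1 : mobius c <= 1 by rewrite -mobius0 leNgt mobius_anti -?leNgt; lra.
rewrite -(@integral_itv_bndoo _ _ _ _ true false); last first.
  by apply: measurable_funTS; apply/measurable_EFinP; exact: measurable_mobius_deriv.
rewrite (_ : 1 - c = - mobius (mobius c) - - mobius 0); last first.
  by rewrite mobius0 mobiusK; [ring|lra].
apply: (@integral_derive _ (fun s => - mobius s)) => //.
- by move=> t /andP[_ tb]; apply: is_derive_mobius; lra.
- move=> t /andP[_ tb]; rewrite /mobius_deriv.
  apply: cvgM; first exact: cvg_cst.
  apply: cvgV; first by rewrite expf_neq0//; lra.
  apply: cvgM; apply: cvgB => //; exact: cvg_cst.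
Qed.

(** Since [mobius] is a decreasing involution, the condition a < phi(s) cuts out
    the interval ]0, phi(max a 0)[, over which its derivative integrates to
    1 - max a 0.  *)
Lemma mobius_tail a :
  (\int[mu]_s ((\1_(`]a, +oo[) (mobius s))%:E * (on01 mobius_deriv s)%:E))%E =
  mu (`]0%R, 1%R[ `&` `]a, +oo[).
Proof.
have lt1x := x1.
have [a1|a1] := leP 1 a.
  rewrite (_ : _ `&` _ = set0); last first.
    by apply/seteqP; split => // s []/=; rewrite !in_itv/=; lra.
  rewrite measure0; apply: integral0_eq => s _.
  rewrite /on01; case: ifP => [s01|_]; last by rewrite mule0.
  rewrite indicE memNset ?mul0e//= in_itv/= andbT.
  by have := mobius01 s01; lra.
(* The half-line may start to the left of 0. *)
pose c := Num.max a 0.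
have c01 : 0 <= c < 1 by rewrite /c le_max lexx orbT gt_max a1 ltr01.
rewrite (_ : _ `&` _ = `]c, 1[%classic); last first.
  by rewrite predeqE => s /=; rewrite !in_itv/= andbT gt_max; split; lra.
rewrite lebesgue_measure_itv/= lte_fin; case/andP: (c01) => _ ->.
rewrite -EFinB -integral_mobius_deriv// [RHS]integral_mkcond.
apply: eq_integral => s _; rewrite /patch /on01 mem_setE in_itv /=.
have [s01|s01] := boolP (0 < s < 1); last first.
  rewrite mule0; case: ifP => // /andP[s0 sb].
  have b1 : mobius c <= 1 by rewrite -mobius0 leNgt mobius_anti -?leNgt; lra.
  by exfalso; lra.
rewrite indicE mem_setE in_itv /= andbT.
have -> : (a < mobius s) = (c < mobius s).
  by rewrite gt_max; have /andP[-> _] := mobius01 s01; rewrite andbT.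
have b1 : mobius c <= 1 by rewrite -mobius0 leNgt mobius_anti -?leNgt; lra.
have -> : (c < mobius s) = (s < mobius c).
  by rewrite -{1}[c]mobiusK; [rewrite mobius_anti; lra|lra].
case/andP: s01 => -> _ /=. by case: (s < mobius c); rewrite /= ?mul1e ?mul0e.
Qed.

End mobius_form.

(** * Convergence of admissible iterated integrals *)

Section finiteness.
Variable R : realType.
Local Notation rT := (measurableTypeR R).
Local Notation mu := (@lebesgue_measure R).

Lemma integral_rsqrt3 (x : R) : 0 < x < 1 ->
  (\int[mu]_(t in `]x, 1%R[) (t * Num.sqrt t)^-1%:E =
   (2 * ((Num.sqrt x)^-1 - 1))%:E)%E.
Proof.
move=> /andP[x0 x1].
have pos (t : R) : x <= t <= 1 -> 0 < Num.sqrt t /\ 0 < t.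
  by move=> /andP[xt _]; rewrite sqrtr_gt0; lra.
rewrite -(@integral_itv_bndoo _ _ _ _ true false); last first.
  apply: measurable_funTS; apply/measurable_EFinP.
  apply: measurable_funV; apply: measurable_funM => //.
  by apply: continuous_measurable_fun; exact: sqrt_continuous.
pose F (t : R) : R := - (2 * (Num.sqrt t)^-1).
have dF (t : R) : x <= t <= 1 -> is_derive t 1 F (t * Num.sqrt t)^-1.
  move=> /pos[s0 t0]; have ? := is_derive1_sqrt t0.
  have r0 : Num.sqrt t != 0 by rewrite gt_eqF.
  apply: is_derive_eq; rewrite /GRing.scale /=; move: r0.
  move: (sqr_sqrtr (ltW t0)); set r := Num.sqrt t => <- r0.
  by field.
have cf (t : R) : x <= t <= 1 ->
    {for t, continuous (fun u : R => (u * Num.sqrt u)^-1 : R)}.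
  move=> /pos[s0 t0]; apply: cvgV; first by rewrite mulf_neq0// gt_eqF.
  by apply: cvgM => //; exact: sqrt_continuous.
have -> : 2 * ((Num.sqrt x)^-1 - 1) = F 1 - F x.
  by rewrite /F sqrtr1 invr1; ring.
exact: (integral_derive x1 dF cf).
Qed.

(** The integrand is unbounded at 0, so the fundamental theorem of calculus is
    applied on [1/(n+1), 1], where it gives at most 2, and n tends to
    infinity.  *)
Lemma integral_rsqrt_lty :
  (\int[mu]_(t in `]0%R, 1%R[) (Num.sqrt t)^-1%:E < +oo)%E.
Proof.
have mf (D : set rT) : measurable_fun D (fun t : rT => (Num.sqrt t)^-1%:E).
  apply: measurable_funTS; apply/measurable_EFinP; apply: measurable_funV.
  by apply: continuous_measurable_fun; exact: sqrt_continuous.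
rewrite integral_itv_bndo_bndc; last exact: mf.
pose F n : set rT := `[(n.+1%:R)^-1%R, 1%R]%classic.
have -> : `]0%R, 1%R]%classic = \bigcup_n F n.
  rewrite predeqE => t; split => /=.
    rewrite in_itv/= => /andP[t0 t1]; exists (Num.truncn t^-1) => //=.
    rewrite /F /= in_itv/= t1 andbT invf_ple ?posrE//.
    by rewrite ltW// truncnS_gt.
  case=> n _; rewrite /F /= !in_itv/= => /andP[nt ->]; rewrite andbT.
  by apply: lt_le_trans nt.
have H := @ge0_nondecreasing_set_cvg_integral _ _ R F (fun t : rT => (Num.sqrt t)^-1%:E) mu.
have {}H : (\int[mu]_(t in F i) (Num.sqrt t)^-1%:E @[i --> \oo] -->
    \int[mu]_(t in \bigcup_i F i) (Num.sqrt t)^-1%:E)%E.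
  apply: H => //.
  - move=> m n mn; apply/subsetPset => t; rewrite /F /= !in_itv/= => /andP[mt ->].
    rewrite andbT (le_trans _ mt)// lef_pV2 ?posrE// ler_nat//.
  - by move=> i; exact: measurable_itv.
rewrite -(cvg_lim (@ereal_hausdorff R) H).
apply: (@le_lt_trans _ _ 2%:E); last exact: ltry.
apply: lime_le; first by apply/cvg_ex; eexists; exact: H.
near=> n.
have n1 : (n.+1%:R)^-1 < 1 :> R.
  rewrite invf_lt1 ?posrE// (@ltr_nat R 1) ltnS; near: n; exact: nbhs_infty_gt.
pose G (t : R) : R := 2 * Num.sqrt t.
have pos (t : R) : (n.+1%:R)^-1 <= t <= 1 -> 0 < t.
  by move=> /andP[nt _]; apply: lt_le_trans nt.
have dG (t : R) : (n.+1%:R)^-1 <= t <= 1 -> is_derive t 1 G (Num.sqrt t)^-1.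
  move=> /pos t0; have ? := is_derive1_sqrt t0.
  have r0 : Num.sqrt t != 0 by rewrite gt_eqF// sqrtr_gt0.
  by apply: is_derive_eq; rewrite /GRing.scale /=; field.
have cg (t : R) : (n.+1%:R)^-1 <= t <= 1 ->
    {for t, continuous (fun u : R => (Num.sqrt u)^-1 : R)}.
  move=> /pos t0.
  by apply: cvgV; [rewrite gt_eqF// sqrtr_gt0|exact: sqrt_continuous].
have -> := integral_derive n1 dG cg.
by rewrite /G lee_fin sqrtr1 mulr1 gerBl mulr_ge0.
Unshelve. all: by end_near. Qed.

(** On the i-th of n variables of a convergent word every form is bounded by a
    multiple of this function: 1/t can occur except at the first place, 1/(1-t)
    except at the last one.  *)
Definition majorant (n i : nat) (t : R) : R :=
  (if i == 0%N then 1 else t^-1) * (if i == n.-1 then 1 else (1 - t)^-1).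

Lemma measurable_majorant n i :
  measurable_fun setT (on01 (majorant n i) : rT -> rT).
Proof.
apply: measurable_on01; apply: measurable_funM.
  by case: (i == 0%N); [exact: measurable_cst|apply: measurable_funV].
case: (i == n.-1); first exact: measurable_cst.
by apply: measurable_funV; apply: measurable_funB.
Qed.

Lemma on01_majorant_ge0 n i t : 0 <= on01 (majorant n i) t.
Proof.
rewrite /on01; case: ifP => // /andP[t0 t1].
by rewrite mulr_ge0//; case: ifP => // _; rewrite invr_ge0; lra.
Qed.

(** The weight V(t) = t^(-1/2) - 1 satisfies -2 V' = t^(-3/2), so an integrand
    bounded by t^(-3/2) has its tail integral bounded by 2 V.  *)
Lemma integral_le_rsqrt3 (x C : R) (G : rT -> \bar R) : 0 < x < 1 -> 0 <= C ->
  measurable_fun setT G -> (forall t, (0 <= G t)%E) ->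
  (forall t, ~~ (x < t < 1) -> G t = 0%E) ->
  (forall t, x < t < 1 -> (G t <= (C * (t * Num.sqrt t)^-1)%:E)%E) ->
  (\int[mu]_t G t <= (C * (2 * ((Num.sqrt x)^-1 - 1)))%:E)%E.
Proof.
move=> x01 C0 mG G0 Gout Gle.
have mf : measurable_fun `]x, 1%R[ (fun t : rT => ((t * Num.sqrt t)^-1)%:E).
  apply: measurable_funTS; apply/measurable_EFinP.
  apply: measurable_funV; apply: measurable_funM => //.
  by apply: continuous_measurable_fun; exact: sqrt_continuous.
rewrite EFinM -integral_rsqrt3// -ge0_integralZl//; last first.
  move=> t; rewrite /= in_itv/= => /andP[xt _]; rewrite lee_fin invr_ge0 mulr_ge0//.
  by lra.
rewrite (_ : (\int[mu]_t G t)%E = (\int[mu]_(t in `]x, 1%R[) G t)%E).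
  apply: ge0_le_integral => //.
  - exact: measurable_funTS.
  - by apply: emeasurable_funM => //; exact: measurable_cst.
rewrite [RHS]integral_mkcond; apply: eq_integral => t _.
rewrite /patch; case: ifPn => //; rewrite notin_setE /= in_itv/= => /negP.
exact: Gout.
Qed.

Lemma first_weight_le (r : R) : 0 < r < 1 ->
  (1 - r ^+ 2)^-1 * (r^-1 - 1) <= r^-1.
Proof.
move=> /andP[r0 r1].
have -> : (1 - r ^+ 2)^-1 * (r^-1 - 1) = r^-1 * (1 + r)^-1.
  have ? : 1 - r ^+ 2 != 0 by rewrite subr_eq0 gt_eqF// expr_lt1// ltW.
  field; do ?[apply/andP; split] => //; lra.
by rewrite ger_pMr ?invr_gt0// invf_le1; lra.
Qed.

Lemma mid_weight_le (r : R) : 0 < r < 1 ->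
  (r ^+ 2)^-1 * (1 - r ^+ 2)^-1 * (r^-1 - 1) <= (r ^+ 2 * r)^-1.
Proof.
move=> r01; rewrite -mulrA [leRHS]invfM ler_wpM2l ?first_weight_le//.
by rewrite invr_ge0 sqr_ge0.
Qed.

Lemma majorant_last n t : (1 < n)%N -> majorant n n.-1 t = t^-1.
Proof. by case: n => [|[|n]]// _; rewrite /majorant /= eqxx mulr1. Qed.

Lemma majorant_mid n i t : (0 < i < n.-1)%N ->
  majorant n i t = t^-1 * (1 - t)^-1.
Proof. by case: i => // i /= lin; rewrite /majorant /= ltn_eqF. Qed.

(** Induction on the number of integrations: V(t) / (t (1-t)) <= t^(-3/2), so
    integrating against the middle majorant maps V below 2 V again.  *)
Lemma upper_iter_majorant_le n m k x : (m.+1 + k)%N = n -> (0 < k)%N ->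
  0 < x < 1 ->
  (upper_iter (fun i => on01 (majorant n i)) m.+1 k x <=
   (2 ^+ m.+1 * ((Num.sqrt x)^-1 - 1))%:E)%E.
Proof.
elim: m k x => [|m IH] k x mkn k0 x01.
  rewrite expr1 -[X in X%:E]mul1r; apply: integral_le_rsqrt3 => //.
  - apply: emeasurable_funM => //; apply/measurable_EFinP.
    apply: measurable_funM; last exact: measurable_majorant.
    exact: measurable_lt_indic.
  - by move=> t; rewrite mule1 lee_fin mulr_ge0// on01_majorant_ge0.
  - move=> t tx; rewrite mule1 /on01; case: ifP => [t01|]; last by rewrite mulr0.
    by case/andP: t01 tx => _ ->; rewrite andbT => /negbTE ->; rewrite mul0r.
  - move=> t /andP[xt t1]; have t0 : 0 < t by lra.
    rewrite mule1 xt mul1r /on01 t0 t1 /= lee_fin.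
    rewrite (_ : k = n.-1); last by rewrite -mkn.
    rewrite majorant_last; last by rewrite -mkn; case: k k0 {mkn}.
    rewrite mul1r lef_pV2 ?posrE ?mulr_gt0 ?sqrtr_gt0//.
    rewrite ger_pMr// -[leRHS]sqrtr1 ler_wsqrtr// ltW//.
rewrite exprSr -mulrA; apply: integral_le_rsqrt3 => //.
- apply: emeasurable_funM.
    apply/measurable_EFinP.
    apply: measurable_funM; last exact: measurable_majorant.
    exact: measurable_lt_indic.
  exact: (@measurable_upper_iter R (fun i => on01 (majorant n i))
    (measurable_majorant n) (on01_majorant_ge0 n) m.+1 k.+1).
- move=> t; rewrite mule_ge0//; last first.
    exact: (@upper_iter_ge0 R (fun i => on01 (majorant n i))
      (on01_majorant_ge0 n) m.+1 k.+1).
  by rewrite lee_fin mulr_ge0// on01_majorant_ge0.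
- move=> t tx; rewrite /on01; case: ifP => [t01|]; last by rewrite mulr0 mul0e.
  by case/andP: t01 tx => _ ->; rewrite andbT => /negbTE ->; rewrite mul0r mul0e.
move=> t /andP[xt t1]; have t0 : 0 < t by lra.
rewrite xt mul1r {1}/on01 t0 t1 /= majorant_mid; last by rewrite -mkn k0 addSn addSn /= ltnS leq_addl.
apply: (le_trans (lee_wpmul2l _ (IH k.+1 t _ _ _))) => //.
- by rewrite lee_fin mulr_ge0 ?invr_ge0//; lra.
- by rewrite -mkn addnS.
- by rewrite t0.
rewrite -EFinM lee_fin mulrCA ler_wpM2l ?exprn_ge0//.
have r0 : 0 < Num.sqrt t by rewrite sqrtr_gt0.
have : Num.sqrt t < 1 by rewrite -[ltRHS]sqrtr1 ltr_sqrt.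
move: r0 (sqr_sqrtr (ltW t0)); set r := Num.sqrt t => r0 <- r1.
by apply: mid_weight_le; rewrite r0.
Qed.

(** The outermost integration has the milder weight 1/(1-t), and
    V(t) / (1-t) <= t^(-1/2) is integrable on ]0,1[.  *)
Lemma upper_iter_majorant_lty n :
  (upper_iter (fun i => on01 (majorant n i)) n 0%N 0%R < +oo)%E.
Proof.
case: n => [|[|n]]; first exact: ltry.
  apply: (@le_lt_trans _ _ (\int[mu]_(t in `]0%R, 1%R[) 1)%E).
    rewrite /= [leRHS]integral_mkcond.
    rewrite le_eqVlt; apply/orP; left; apply/eqP; apply: eq_integral => t _.
    rewrite mule1 /patch /on01 mem_setE in_itv/=; case: ifP => //; last by rewrite mulr0.
    by move=> /andP[-> _]; rewrite /majorant /= !mulr1.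
  by rewrite integral_cst//= lebesgue_measure_itv/= lte_fin ltr01 oppr0 adde0 mule1 ltry.
apply: (@le_lt_trans _ _
   (\int[mu]_(t in `]0%R, 1%R[) ((2 ^+ n.+1)%:E * (Num.sqrt t)^-1%:E))%E).
  rewrite [leRHS]integral_mkcond [leLHS]/=; apply: ge0_le_integral => //.
  - move=> t _; rewrite mule_ge0//; last first.
      exact: (@upper_iter_ge0 R (fun i => on01 (majorant n.+2 i))
        (on01_majorant_ge0 _) n.+1 1).
    by rewrite lee_fin mulr_ge0// on01_majorant_ge0.
  - apply: emeasurable_funM.
      apply/measurable_EFinP.
      apply: measurable_funM; last exact: measurable_majorant.
      exact: measurable_lt_indic.
    exact: (@measurable_upper_iter R (fun i => on01 (majorant n.+2 i))
      (measurable_majorant _) (on01_majorant_ge0 _) n.+1 1).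
  - apply/(measurable_restrictT _ _).1 => //; apply: measurable_funTS.
    apply: emeasurable_funM => //; apply/measurable_EFinP; apply: measurable_funV.
    by apply: continuous_measurable_fun; exact: sqrt_continuous.
  move=> t _; rewrite /patch mem_setE in_itv/= {1}/on01.
  case: ifP => [/andP[t0 t1]|_]; last by rewrite mulr0 mul0e.
  rewrite t0 mul1r /majorant /= mul1r.
  apply: (le_trans (lee_wpmul2l _ (@upper_iter_majorant_le n.+2 n 1 t _ _ _))) => //.
  - by rewrite lee_fin invr_ge0; lra.
  - by rewrite addn1.
  - by rewrite t0.
  rewrite -!EFinM lee_fin mulrCA ler_wpM2l ?exprn_ge0//.
  have r0 : 0 < Num.sqrt t by rewrite sqrtr_gt0.
  have : Num.sqrt t < 1 by rewrite -[ltRHS]sqrtr1 ltr_sqrt.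
  move: r0 (sqr_sqrtr (ltW t0)); set r := Num.sqrt t => r0 <- r1.
  by apply: first_weight_le; rewrite r0.
rewrite ge0_integralZl//.
- by rewrite lte_mul_pinfty// ?lee_fin// integral_rsqrt_lty.
- apply: measurable_funTS; apply/measurable_EFinP; apply: measurable_funV.
  by apply: continuous_measurable_fun; exact: sqrt_continuous.
Qed.

End finiteness.

(** * Power series with polynomially bounded coefficients *)

Section expansion.
Variable K : numFieldType.
Implicit Types (F G : K -> K) (h : nat -> K) (C : K) (m : nat).

(** [F] is the sum of the power series with coefficients [h] on the punctured
    unit disc, in a quantitative form: the bounds survive integration of
    [F], [h] and [C] over a parameter.  The point 0 is left out because it
    corresponds to z = infinity.  *)
Definition expansion F h C m :=
  (forall n, `|h n| <= C * n.+1%:R ^+ m) /\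
  (forall N s, s != 0 -> `|s| < 1 ->
     `|F s - \sum_(i < N) h i * s ^+ i| <=
       C * N.+1%:R ^+ m * `|s| ^+ N / (1 - `|s|) ^+ m).

(** The coefficients of the quotient of the series [h] by 1 - b s.  *)
Fixpoint geom_coef (b : K) h n : K :=
  if n is n'.+1 then h n + b * geom_coef b h n' else h 0%N.

Definition shift_coef h n : K := if n is n'.+1 then h n' else 0.

Lemma expansion_ge0 F h C m : expansion F h C m -> 0 <= C.
Proof.
case=> /(_ 0%N) H _; move: H; rewrite expr1n mulr1; exact: le_trans.
Qed.

Lemma expansion_ext F G h C m :
  (forall s, s != 0 -> `|s| < 1 -> F s = G s) ->
  expansion F h C m -> expansion G h C m.
Proof. by move=> FG [hC FC]; split=> // N s s0 s1; rewrite -FG// FC. Qed.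

Lemma expansion0 m : expansion (fun=> 0) (fun=> 0) 0 m.
Proof.
split=> [n|N s s0 s1]; first by rewrite normr0 mul0r.
by rewrite big1 ?subrr ?normr0 ?mul0r// => i _; rewrite mul0r.
Qed.

Lemma expansion1 : expansion (fun=> 1) (fun n => (n == 0%N)%:R) 1 0.
Proof.
split=> [n|N s s0 s1].
  by rewrite expr0 mulr1; case: eqP => _; rewrite ?normr1 ?normr0.
rewrite !expr0 !mul1r divr1; case: N => [|N].
  by rewrite big_ord0 subr0 normr1 expr0.
rewrite big_ord_recl big1 /= => [|i _]; last by rewrite mul0r.
by rewrite expr0 mulr1 addr0 subrr normr0 exprn_ge0.
Qed.

Lemma expansionZ F h C m c : expansion F h C m ->
  expansion (fun s => c * F s) (fun n => c * h n) (`|c| * C) m.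
Proof.
case=> hC FC; split=> [n|N s s0 s1].
  by rewrite normrM -mulrA ler_wpM2l.
have -> : \sum_(i < N) c * h i * s ^+ i = c * \sum_(i < N) h i * s ^+ i.
  by rewrite mulr_sumr; apply: eq_bigr => i _; rewrite mulrA.
by rewrite -mulrBr normrM -!mulrA ler_wpM2l// !mulrA FC.
Qed.

Lemma expansionD F G h g C C' m : expansion F h C m -> expansion G g C' m ->
  expansion (fun s => F s + G s) (fun n => h n + g n) (C + C') m.
Proof.
move=> [hC FC] [gC GC]; split=> [n|N s s0 s1].
  by rewrite mulrDl (le_trans (ler_normD _ _))// lerD.
have -> : \sum_(i < N) (h i + g i) * s ^+ i =
    \sum_(i < N) h i * s ^+ i + \sum_(i < N) g i * s ^+ i.
  by rewrite -big_split; apply: eq_bigr => i _; rewrite mulrDl.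
by rewrite opprD addrACA (le_trans (ler_normD _ _))// !mulrDl lerD ?FC ?GC.
Qed.

Lemma expansion_weaken F h C C' m m' : C <= C' -> (m <= m')%N ->
  expansion F h C m -> expansion F h C' m'.
Proof.
move=> CC' mm' E; have C0 := expansion_ge0 E; case: E => hC FC.
have P (n : nat) : (n.+1%:R : K) ^+ m <= n.+1%:R ^+ m'.
  by rewrite ler_weXn2l// ler1n.
split=> [n|N s s0 s1].
  by rewrite (le_trans (hC n))// ler_pM ?exprn_ge0.
have s1' : 0 < 1 - `|s| by rewrite subr_gt0.
rewrite (le_trans (FC N s s0 s1))// ler_pM ?mulr_ge0 ?exprn_ge0 ?invr_ge0 ?exprn_ge0 ?(ltW s1')//.
  by rewrite ler_pM ?mulr_ge0 ?exprn_ge0// ler_pM ?exprn_ge0.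
by rewrite lef_pV2 ?posrE ?exprn_gt0// ler_wiXn2l// ?(ltW s1')// gerBl.
Qed.

Lemma expansion_shift F h C m : expansion F h C m ->
  expansion (fun s => s * F s) (shift_coef h) C m.
Proof.
move=> E; have C0 := expansion_ge0 E; case: E => hC FC.
split=> [[|n]|[|N] s s0 s1] /=.
- by rewrite normr0 mulr_ge0 ?exprn_ge0.
- rewrite (le_trans (hC n))// ler_wpM2l// lerXn2r ?nnegrE// ler_nat//.
- have := FC 0%N s s0 s1; rewrite !big_ord0 !subr0 normrM => H.
  by rewrite (le_trans _ H)// ler_piMl// ltW.
have s1' : 0 < 1 - `|s| by rewrite subr_gt0.
have -> : \sum_(i < N.+1) shift_coef h i * s ^+ i = s * \sum_(i < N) h i * s ^+ i.
  rewrite big_ord_recl /= mul0r add0r mulr_sumr; apply: eq_bigr => i _.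
  by rewrite /= exprS mulrCA.
rewrite -mulrBr normrM (le_trans (ler_wpM2l _ (FC N s s0 s1)))//.
rewrite exprS [leLHS](_ : _ = (C * N.+1%:R ^+ m) * (`|s| * `|s| ^+ N / (1 - `|s|) ^+ m)); last first.
  by rewrite -!mulrA mulrCA; congr (_ * _); rewrite mulrCA.
rewrite -[leRHS]mulrA ler_wpM2r ?mulr_ge0 ?invr_ge0 ?exprn_ge0 ?(ltW s1')//.
by rewrite ler_wpM2l// lerXn2r ?nnegrE// ler_nat.
Qed.

Lemma geom_le b h C m : `|b| <= 1 -> (forall n, `|h n| <= C * n.+1%:R ^+ m) ->
  forall n, `|geom_coef b h n| <= C * n.+1%:R ^+ m.+1.
Proof.
move=> b1 hC; have C0 : 0 <= C.
  by move: (hC 0%N); rewrite expr1n mulr1; exact: le_trans.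
elim=> [|n IH] /=; first by rewrite (le_trans (hC 0%N))// !expr1n.
rewrite (le_trans (ler_normD _ _))// exprSr -(natr1 n.+1) mulrDr mulr1 mulrDr.
rewrite addrC lerD//; last by rewrite natr1 hC.
rewrite normrM (le_trans (ler_wpM2r _ b1))// mul1r (le_trans IH)//.
rewrite ler_wpM2l// exprSr natr1 ler_wpM2r// lerXn2r ?nnegrE// ler_nat//.
Qed.

(** With d the coefficients of F/(1 - b s), the remainder after N terms is
    (R + b d_(N-1) s^N) / (1 - b s), where R is the remainder of F; the two
    summands fit in the bound because
    (N+1)^m + N (N+1)^m = (N+1)^(m+1).  *)
Lemma expansion_geom b F h C m : `|b| <= 1 -> expansion F h C m ->
  expansion (fun s => F s / (1 - b * s)) (geom_coef b h) C m.+1.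
Proof.
move=> b1 E; have C0 := expansion_ge0 E; case: E => hC FC.
have gC := geom_le b1 hC.
split=> // N s s0 s1.
have s1' : 0 < 1 - `|s| by rewrite subr_gt0.
have bs : 1 - `|s| <= `|1 - b * s|.
  rewrite (le_trans _ (lerB_dist _ _))// normr1 lerB// normrM.
  by rewrite ler_piMl.
have bs0 : 1 - b * s != 0 by rewrite -normr_gt0 (lt_le_trans s1').
pose g' := shift_coef (geom_coef b h) N.
have -> : F s / (1 - b * s) - \sum_(i < N) geom_coef b h i * s ^+ i =
    (F s - \sum_(i < N) h i * s ^+ i + b * g' * s ^+ N) / (1 - b * s).
  apply: (mulIf bs0); rewrite mulrBl !divfK//.
  rewrite -[RHS]addrA; congr (_ + _); rewrite /g' {g'}.
  elim: N => [|[|N] IH].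
  - by rewrite !big_ord0 /= mulr0 !mul0r addr0.
  - by rewrite !big_ord1 /=; ring.
  - rewrite big_ord_recr mulrDl opprD IH [\sum_(i < N.+2) h i * _]big_ord_recr /=.
    rewrite [s ^+ N.+2]exprS; ring.
rewrite normrM normfV.
apply: (@le_trans _ _ (C * N.+1%:R ^+ m.+1 * `|s| ^+ N / (1 - `|s|) ^+ m / (1 - `|s|))); last first.
  by rewrite -[leLHS]mulrA -invfM -exprSr.
rewrite ler_pM ?invr_ge0//; last by rewrite lef_pV2 ?posrE// normr_gt0.
apply: (@le_trans _ _ (C * N.+1%:R ^+ m * `|s| ^+ N / (1 - `|s|) ^+ m +
   C * (N%:R * N.+1%:R ^+ m) * `|s| ^+ N / (1 - `|s|) ^+ m)); last first.
  have -> : N.+1%:R ^+ m.+1 = N.+1%:R ^+ m + N%:R * N.+1%:R ^+ m :> K.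
    by rewrite exprS -{1}natr1 mulrDl mul1r addrC.
  by rewrite mulrDr !mulrDl.
rewrite (le_trans (ler_normD _ _))// lerD ?FC// !normrM normrX.
have g'C : `|g'| <= C * (N%:R * N.+1%:R ^+ m).
  rewrite /g'; case: N {g'} => [|n] /=; first by rewrite normr0 mul0r mulr0.
  rewrite (le_trans (gC n))// ler_wpM2l// exprS ler_wpM2l//.
  by rewrite lerXn2r ?nnegrE// ler_nat.
have s11 : 1 <= ((1 - `|s|) ^+ m)^-1.
  by rewrite invf_ge1 ?exprn_gt0// exprn_ile1 ?(ltW s1')// gerBl.
rewrite (le_trans (ler_wpM2r _ (ler_wpM2r _ b1)))// mul1r.
rewrite (le_trans (ler_wpM2r _ g'C)) ?exprn_ge0//.
by rewrite ler_peMr// !mulr_ge0 ?exprn_ge0.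
Qed.

(** If h_0, ..., h_(N-1) vanish, the remainder bound at N+1 gives
    |h_N| <= D r for all small r > 0.  *)
Lemma expansion_coef0 F h C m : expansion F h C m ->
  (forall r, 0 < r < 1 -> F r = 0) -> forall n, h n = 0.
Proof.
move=> E F0; have C0 := expansion_ge0 E; case: E => _ FC.
elim/ltn_ind=> N IH; apply/eqP/negPn/negP => hN0.
have hN : 0 < `|h N| by rewrite normr_gt0.
pose D := C * N.+2%:R ^+ m * 2 ^+ m.
have D0 : 0 <= D by rewrite !mulr_ge0 ?exprn_ge0.
have hD : 0 < `|h N| + D by rewrite ltr_pwDl.
(* Small enough for D r < |h_N|, and at most 1/2. *)
pose r := `|h N| / (2 * (`|h N| + D)).
have r0 : 0 < r by rewrite divr_gt0// mulr_gt0.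
have r12 : r <= 2^-1.
  by rewrite /r invfM mulrCA ler_piMr ?invr_ge0// ler_pdivrMr// mul1r lerDl.
have r1 : r < 1 by rewrite (le_lt_trans r12)// invf_lt1// ltr1n.
have nr : `|r| = r by rewrite ger0_norm// ltW.
have := FC N.+1 r; rewrite gt_eqF// nr => /(_ isT r1).
rewrite F0 ?r0// big_ord_recr big1 /= => [|i _]; last by rewrite IH// mul0r.
rewrite !add0r normrN normrM normrX nr exprS.
rewrite (_ : _ / _ = (C * N.+2%:R ^+ m / (1 - r) ^+ m * r) * r ^+ N); last by ring.
rewrite ler_pM2r ?exprn_gt0// => H.
have {}H : `|h N| <= D * r.
  rewrite (le_trans H)// ler_wpM2r ?(ltW r0)// ler_wpM2l ?mulr_ge0 ?exprn_ge0//.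
  rewrite -exprVn lerXn2r ?nnegrE ?invr_ge0 ?subr_ge0 ?(ltW r1)//.
  by rewrite -[leRHS]invrK lef_pV2 ?posrE ?subr_gt0 ?invr_gt0// lerBrDr -lerBrDl
    (le_trans r12)// lerBrDr -mulr2n -(mulr_natr 2^-1) mulVf.
have : `|h N| < `|h N|.
  rewrite (le_lt_trans H)// /r mulrA ltr_pdivrMr ?mulr_gt0//.
  rewrite mulrC ltr_pM2l// (@lt_le_trans _ _ (`|h N| + D)) ?ltrDr//.
  by rewrite ler_peMl ?(ltW hD)// ler1n.
by rewrite ltxx.
Qed.

End expansion.

Section identity_theorem.
Variable R : realType.

Lemma poly_geom_bounded m (r : R) : 0 <= r < 1 ->
  exists B, forall N, N.+1%:R ^+ m * r ^+ N <= B.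
Proof.
elim: m r => [|m IH] r /andP[r0 r1].
  by exists 1 => N; rewrite expr0 mul1r exprn_ile1// ltW.
pose p := Num.sqrt r.
have p1 : p < 1 by rewrite -[ltRHS]sqrtr1 ltr_sqrt.
have p0 : 0 <= p by rewrite sqrtr_ge0.
(* One factor N+1 is absorbed by p^N, the other m by the second p^N. *)
have [B HB] := IH p (introT andP (conj p0 p1)).
have key N : N.+1%:R * p ^+ N * (1 - p) <= 1.
  (* Bernoulli's inequality for 1/p. *)
  suff : p ^+ N * (1 + N%:R * (1 - p)) <= 1.
    apply: le_trans; rewrite mulrAC mulrC -natr1 mulrDl mul1r addrC.
    by rewrite ler_wpM2l ?exprn_ge0// lerD2r gerBl.
  elim: N => [|N IHN]; first by rewrite expr0 mul0r addr0 mulr1.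
  rewrite (le_trans _ IHN)// exprSr -mulrA ler_wpM2l ?exprn_ge0// -natr1.
  have : 0 <= (N%:R + 1) * (1 - p) ^+ 2 by rewrite mulr_ge0 ?addr_ge0 ?sqr_ge0.
  by nra.
exists ((1 - p)^-1 * B) => N.
rewrite -[in r ^+ N](sqr_sqrtr r0) -/p exprS -exprM mulnC exprM expr2.
rewrite (_ : _ * _ * _ = (N.+1%:R * p ^+ N) * (N.+1%:R ^+ m * p ^+ N)); last by ring.
rewrite ler_pM ?mulr_ge0 ?exprn_ge0//.
by rewrite -[leRHS]mul1r ler_pdivlMr ?subr_gt0.
Qed.

Lemma complex_ge0E (x : R[i]) : 0 <= x -> exists2 a : R, 0 <= a & x = (a%:C)%C.
Proof.
move=> x0; exists (complex.Re x); last by rewrite RRe_real// ger0_real.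
by move: x0; rewrite lecE => /andP[_].
Qed.

(** The identity theorem for these expansions: the coefficients vanish, so F(s)
    equals its own remainders, which tend to 0.  *)
Lemma expansion_eq0 (F : R[i] -> R[i]) h C m : expansion F h C m ->
  (forall r : R, 0 < r < 1 -> F (r%:C)%C = 0) ->
  forall s, s != 0 -> `|s| < 1 -> F s = 0.
Proof.
move=> E F0 s s0 s1; have C0 := expansion_ge0 E.
have h0 : forall n, h n = 0.
  apply: (expansion_coef0 E) => r /andP[r0 r1].
  have [a _ ra] := complex_ge0E (ltW r0).
  by rewrite ra F0// -!ltcR -ra r0.
case: E => _ FC.
have [c c0 cE] := complex_ge0E C0.
have [r r0 rE] := complex_ge0E (normr_ge0 s).
have [f f0 fE] := complex_ge0E (normr_ge0 (F s)).
have r1 : r < 1 by rewrite -ltcR -rE.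
apply/eqP; rewrite -normr_eq0 fE (inj_eq (@complexI _)).
have [B HB] := poly_geom_bounded m.+1 (introT andP (conj r0 r1)).
have key N : N.+1%:R * f <= c / (1 - r) ^+ m * B.
  have := FC N s s0 s1; rewrite big1 => [|i _]; last by rewrite h0 mul0r.
  rewrite subr0 fE cE rE -!(rmorph_nat (real_complex R)) -(rmorph1 (real_complex R)).
  rewrite -(rmorphB (real_complex R)) -!(rmorphXn (real_complex R)).
  rewrite -(fmorphV (real_complex R)) -!(rmorphM (real_complex R)) lecR => H.
  rewrite (le_trans (ler_wpM2l _ H))//.
  rewrite [leLHS](_ : _ = c / (1 - r) ^+ m * (N.+1%:R ^+ m.+1 * r ^+ N)); last by rewrite exprS; ring.
  by rewrite ler_wpM2l// divr_ge0// exprn_ge0// subr_ge0 ltW.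
apply/negPn/negP => fn0.
have fp : 0 < f by rewrite lt_neqAle eq_sym fn0.
have := key (Num.truncn (c / (1 - r) ^+ m * B / f)).
by rewrite -ler_pdivlMr// leNgt truncnS_gt.
Qed.

End identity_theorem.

(** * Integrals of complex-valued functions *)

Section complex_integral.
Context d (T : measurableType d) (R : realType).
Variables (mu : {measure set T -> \bar R}) (D : set T).
Hypothesis mD : measurable D.
Local Notation Re := (@complex.Re R).
Local Notation Im := (@complex.Im R).
Implicit Types (f g : T -> R[i]) (b : T -> R).

Definition cmeasurable f :=
  measurable_fun D (fun t => Re (f t)) /\ measurable_fun D (fun t => Im (f t)).

Definition cintegrable f :=
  mu.-integrable D (fun t => (Re (f t))%:E) /\
  mu.-integrable D (fun t => (Im (f t))%:E).

Lemma ReD (x y : R[i]) : Re (x + y) = Re x + Re y.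
Proof. by case: x y => ? ? []. Qed.

Lemma ImD (x y : R[i]) : Im (x + y) = Im x + Im y.
Proof. by case: x y => ? ? []. Qed.

Lemma ReM (x y : R[i]) : Re (x * y) = Re x * Re y - Im x * Im y.
Proof. by case: x y => ? ? []. Qed.

Lemma ImM (x y : R[i]) : Im (x * y) = Re x * Im y + Im x * Re y.
Proof. by case: x y => ? ? []. Qed.

Lemma cmeasurable_cst c : cmeasurable (fun=> c).
Proof. by split; exact: measurable_cst. Qed.

Lemma cmeasurable_real b : measurable_fun D b ->
  cmeasurable (fun t => (b t)%:C)%C.
Proof. by move=> mb; split => //=; exact: measurable_cst. Qed.

Lemma cmeasurableD f g : cmeasurable f -> cmeasurable g ->
  cmeasurable (fun t => f t + g t).
Proof.
move=> [fr fi] [gr gi]; split.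
  by under eq_fun do rewrite ReD; exact: measurable_funD.
by under eq_fun do rewrite ImD; exact: measurable_funD.
Qed.

Lemma cmeasurableM f g : cmeasurable f -> cmeasurable g ->
  cmeasurable (fun t => f t * g t).
Proof.
move=> [fr fi] [gr gi]; split.
  by under eq_fun do rewrite ReM; apply: measurable_funB; exact: measurable_funM.
by under eq_fun do rewrite ImM; apply: measurable_funD; exact: measurable_funM.
Qed.

Lemma cmeasurable_sum I (r : seq I) (F : I -> T -> R[i]) :
  (forall i, cmeasurable (F i)) -> cmeasurable (fun t => \sum_(i <- r) F i t).
Proof.
move=> mF; elim: r => [|i r IH].
  by under [fun _ => _]eq_fun do rewrite big_nil; exact: cmeasurable_cst.
by under [fun _ => _]eq_fun do rewrite big_cons; exact: cmeasurableD.
Qed.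

Lemma cmeasurable_prod I (r : seq I) (F : I -> T -> R[i]) :
  (forall i, cmeasurable (F i)) -> cmeasurable (fun t => \prod_(i <- r) F i t).
Proof.
move=> mF; elim: r => [|i r IH].
  by under [fun _ => _]eq_fun do rewrite big_nil; exact: cmeasurable_cst.
by under [fun _ => _]eq_fun do rewrite big_cons; exact: cmeasurableM.
Qed.

Lemma eq_cintegrable f g : (forall t, D t -> f t = g t) ->
  cintegrable f -> cintegrable g.
Proof.
move=> fg [fr fi]; split.
  by apply: eq_integrable fr => // t /[!inE] /fg ->.
by apply: eq_integrable fi => // t /[!inE] /fg ->.
Qed.

Lemma eq_cintegral f g : (forall t, D t -> f t = g t) ->
  cintegral mu D f = cintegral mu D g.
Proof.
move=> fg; rewrite /cintegral.
by congr (_ +i* _)%C; apply: eq_Rintegral => t /[!inE] /fg ->.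
Qed.

Lemma cintegrable0 : cintegrable (fun=> 0).
Proof. by split; exact: integrable0. Qed.

Lemma cintegral0 : cintegral mu D (fun=> 0) = 0.
Proof. by rewrite /cintegral /Rintegral !integral0. Qed.

Lemma cintegrableD f g : cintegrable f -> cintegrable g ->
  cintegrable (fun t => f t + g t).
Proof.
move=> [fr fi] [gr gi]; split.
  rewrite (_ : (fun _ => _) = (fun t => (Re (f t))%:E + (Re (g t))%:E)%E).
    exact: integrableD.
  by apply/funext => t; rewrite ReD.
rewrite (_ : (fun _ => _) = (fun t => (Im (f t))%:E + (Im (g t))%:E)%E).
  exact: integrableD.
by apply/funext => t; rewrite ImD.
Qed.

Lemma integrable_lincomb (b b' : T -> R) (k l : R) :
  mu.-integrable D (EFin \o b) -> mu.-integrable D (EFin \o b') ->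
  mu.-integrable D (fun t => (k * b t + l * b' t)%:E) /\
  (\int[mu]_(t in D) (k * b t + l * b' t) =
   k * (\int[mu]_(t in D) b t) + l * (\int[mu]_(t in D) b' t))%R.
Proof.
move=> ib ib'.
have ikb := integrableZl mD k ib; have ilb := integrableZl mD l ib'.
split; first exact: (integrableD mD ikb ilb).
by rewrite -!RintegralZl// -RintegralD.
Qed.

Lemma cintegrableZ c f : cintegrable f -> cintegrable (fun t => c * f t).
Proof.
move=> [fr fi]; split.
  have [H _] := integrable_lincomb (Re c) (- Im c) fr fi.
  by apply: eq_integrable H => // t _; rewrite ReM mulNr.
have [H _] := integrable_lincomb (Im c) (Re c) fr fi.
by apply: eq_integrable H => // t _; rewrite ImM addrC.
Qed.

Lemma cintegralD f g : cintegrable f -> cintegrable g ->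
  cintegral mu D (fun t => f t + g t) = cintegral mu D f + cintegral mu D g.
Proof.
move=> [fr fi] [gr gi]; rewrite /cintegral /=; apply/eqP; rewrite eq_complex /=.
under eq_Rintegral do rewrite ReD.
under [X in _ && (X == _)]eq_Rintegral do rewrite ImD.
by rewrite !RintegralD// !eqxx.
Qed.

Lemma cintegralZ c f : cintegrable f ->
  cintegral mu D (fun t => c * f t) = c * cintegral mu D f.
Proof.
move=> [fr fi]; rewrite /cintegral; apply/eqP; rewrite eq_complex ReM ImM /=.
have [_ H] := integrable_lincomb (Re c) (- Im c) fr fi.
have [_ H'] := integrable_lincomb (Im c) (Re c) fr fi.
under eq_Rintegral do rewrite ReM -mulNr.
under [X in _ && (X == _)]eq_Rintegral do rewrite ImM addrC.
by rewrite H H' mulNr eqxx addrC eqxx.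
Qed.

Lemma cintegral_sum I (r : seq I) (F : I -> T -> R[i]) :
  (forall i, cintegrable (F i)) ->
  cintegrable (fun t => \sum_(i <- r) F i t) /\
  cintegral mu D (fun t => \sum_(i <- r) F i t) =
  \sum_(i <- r) cintegral mu D (F i).
Proof.
move=> iF; elim: r => [|i r [IH1 IH2]].
  under [fun _ => _]eq_fun do rewrite big_nil.
  by rewrite big_nil cintegral0; split; [exact: cintegrable0|].
have E : (fun t => \sum_(i <- i :: r) F i t) = (fun t => F i t + \sum_(j <- r) F j t).
  by apply/funext => t; rewrite big_cons.
by rewrite E big_cons; split; [exact: cintegrableD|rewrite cintegralD// IH2].
Qed.

Lemma normc_i : `|'i%C| = 1 :> R[i].
Proof. by rewrite normc_def /= expr0n expr1n add0r sqrtr1. Qed.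

Lemma normc_real (a : R) : `|(a%:C)%C| = (`|a|%:C)%C :> R[i].
Proof. by rewrite normc_def /= expr0n addr0 sqrtr_sqr. Qed.

Lemma normc_leP (x : R[i]) (a : R) : `|x| <= (a%:C)%C ->
  `|Re x| <= a /\ `|Im x| <= a.
Proof.
move=> xa; split; rewrite -lecR; apply: le_trans xa; first exact: normc_ge_Re.
have := normc_ge_Re (x * 'i%C).
by rewrite ReiNIm normrN normrM normc_i mulr1.
Qed.

Lemma normc_le_sum (x : R[i]) : `|x| <= ((`|Re x| + `|Im x|)%:C)%C.
Proof.
rewrite rmorphD {1}[x]complexE (le_trans (ler_normD _ _))//.
by rewrite normrM normc_i mul1r !normc_real.
Qed.

Lemma integrable_dominated b b' : measurable_fun D b ->
  mu.-integrable D (EFin \o b') -> (forall t, D t -> `|b t| <= b' t) ->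
  mu.-integrable D (EFin \o b) /\
  `|\int[mu]_(t in D) b t| <= \int[mu]_(t in D) b' t.
Proof.
move=> mb ib' bb'.
have ib : mu.-integrable D (EFin \o b).
  apply: le_integrable ib' => //; first exact/measurable_EFinP.
  by move=> t Dt; rewrite lee_fin (le_trans (bb' t Dt))// ler_norm.
split=> //; apply: (le_trans (le_normr_Rintegral mD ib)).
by apply: le_Rintegral => //; exact: integrable_norm.
Qed.

Lemma cintegral_dominated f b : cmeasurable f ->
  mu.-integrable D (EFin \o b) -> (forall t, D t -> `|f t| <= ((b t)%:C)%C) ->
  cintegrable f /\
  `|cintegral mu D f| <= ((2 * \int[mu]_(t in D) b t)%:C)%C.
Proof.
move=> [mr mi] ib fb.
have [ir lr] : mu.-integrable D (EFin \o (fun t => Re (f t))) /\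
    `|\int[mu]_(t in D) Re (f t)| <= \int[mu]_(t in D) b t.
  by apply: integrable_dominated => // t /fb/normc_leP[].
have [ii li] : mu.-integrable D (EFin \o (fun t => Im (f t))) /\
    `|\int[mu]_(t in D) Im (f t)| <= \int[mu]_(t in D) b t.
  by apply: integrable_dominated => // t /fb/normc_leP[].
split; first by split.
apply: (le_trans (normc_le_sum _)); rewrite /cintegral /= lecR.
by rewrite mulr_natl mulr2n lerD.
Qed.

(** Term-by-term integration; the uniform remainder bound replaces dominated
    convergence.  *)
Lemma expansion_cintegral (F : T -> R[i] -> R[i]) (h : T -> nat -> R[i]) b m :
  mu.-integrable D (EFin \o b) ->
  (forall n, cmeasurable (fun t => h t n)) ->
  (forall s, cmeasurable (fun t => F t s)) ->
  (forall t, D t -> expansion (F t) (h t) ((b t)%:C)%C m) ->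
  expansion (fun s => cintegral mu D (fun t => F t s))
    (fun n => cintegral mu D (fun t => h t n))
    ((2 * \int[mu]_(t in D) b t)%:C)%C m.
Proof.
move=> ib mh mF E.
have dom (f : T -> R[i]) (k : R) : cmeasurable f -> 0 <= k ->
    (forall t, D t -> `|f t| <= ((b t)%:C)%C * (k%:C)%C) ->
    cintegrable f /\
    `|cintegral mu D f| <= ((2 * \int[mu]_(t in D) b t)%:C)%C * (k%:C)%C.
  move=> mf k0 fk.
  have ibk : mu.-integrable D (EFin \o (fun t => k * b t)) by exact: (integrableZl mD k ib).
  have [] := cintegral_dominated mf ibk.
    by move=> t /fk; rewrite -rmorphM mulrC.
  by rewrite RintegralZl// -rmorphM mulrCA mulrC.
have ih n : cintegrable (fun t => h t n) /\
    `|cintegral mu D (fun t => h t n)| <=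
      ((2 * \int[mu]_(t in D) b t)%:C)%C * n.+1%:R ^+ m.
  have -> : n.+1%:R ^+ m = ((n.+1%:R ^+ m : R)%:C)%C by rewrite rmorphXn rmorph_nat.
  apply: dom => //.
  by move=> t /E[+ _] => /(_ n); rewrite rmorphXn rmorph_nat.
split=> [n|N s s0 s1]; first by case: (ih n).
have ihs (i : nat) : cintegrable (fun t => - (h t i * s ^+ i)).
  have [H _] := ih i.
  rewrite (_ : (fun _ => _) = (fun t => - s ^+ i * h t i)); last first.
    by apply/funext => t; rewrite mulNr mulrC.
  exact: cintegrableZ.
have [k k0 kE] : exists2 k : R, 0 <= k &
    N.+1%:R ^+ m * `|s| ^+ N / (1 - `|s|) ^+ m = (k%:C)%C.
  apply: complex_ge0E; rewrite !mulr_ge0 ?exprn_ge0 ?invr_ge0//.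
  by rewrite exprn_ge0// subr_ge0 ltW.
have [iS eS] := @cintegral_sum _ (index_enum 'I_N) (fun (i : 'I_N) t => - (h t i * s ^+ i))
  (fun i => ihs i).
have mS : cmeasurable (fun t => F t s + \sum_(i < N) - (h t i * s ^+ i)).
  apply: cmeasurableD => //; apply: cmeasurable_sum => i.
  rewrite (_ : (fun _ => _) = (fun t => - s ^+ i * h t i)); last first.
    by apply/funext => t; rewrite mulNr mulrC.
  by apply: cmeasurableM => //; exact: cmeasurable_cst.
have FS t : D t -> `|F t s + \sum_(i < N) - (h t i * s ^+ i)| <= ((b t)%:C)%C * (k%:C)%C.
  by move=> /E[_ /(_ N s s0 s1)]; rewrite sumrN -kE !mulrA.
have [iFS lFS] := dom _ _ mS k0 FS.
have iF : cintegrable (fun t => F t s).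
  have := cintegrableD iFS (cintegrableZ (-1) iS).
  congr cintegrable; apply/funext => t.
  by rewrite mulN1r addrK.
rewrite -!mulrA [X in _ * X]mulrA kE; apply: le_trans lFS.
rewrite cintegralD// eS -sumrN le_eqVlt; apply/orP; left; apply/eqP.
congr (`| _ + _ |); apply: eq_bigr => i _; have [H _] := ih i.
have -> : (fun t => - (h t i * s ^+ i)) = (fun t => - s ^+ i * h t i).
  by apply/funext => t; rewrite mulNr mulrC.
by rewrite cintegralZ// mulNr mulrC.
Qed.

End complex_integral.

(** * Word integrals as power series *)

Section word_integral.
Variable R : realType.
Local Notation rT := (measurableTypeR R).
Local Notation K := R[i].

Definition form (z : K) (l : letter) (t : R) : K := ((t%:C)%C - Defs.point z l)^-1.

(** The letters are given by a function on all natural numbers so that words of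
    equal length obtained in different ways can be compared without casts.  *)
Definition word_integral (z : K) n (a : nat -> letter) : K :=
  cintegral (lebesgue_tuple R n) (@simplex R n)
    (fun t => \prod_(i < n) form z (a i) (tnth t i)).

Definition admissible n (a : nat -> letter) := forall i, (i < n)%N ->
  (i = 0%N -> a i <> l0) /\ (i = n.-1 -> a i <> l1).

(** 2 z - 1 = (s + 1/s)/2: an affine form of the Joukowski map, which sends the
    punctured disc onto the complement of [0,1] and the unit circle to [0,1].  *)
Definition joukowski (s : K) : K := (1 + s) ^+ 2 / (4 * s).

(** The preimage of [t] on the unit circle under the extension of
    [joukowski].  *)
Definition unit_root (t : R) : K := ((2 * t - 1) +i* (2 * Num.sqrt (t * (1 - t))))%C.

Arguments unit_root : simpl never.

Lemma unit_root_mulJ t : 0 <= t <= 1 -> unit_root t * (unit_root t)^*%C = 1.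
Proof.
move=> /andP[t0 t1]; rewrite -sqr_normc -add_Re2_Im2 /unit_root /= exprMn sqr_sqrtr.
  by rewrite (_ : _ + _ = 1) //; ring.
by rewrite mulr_ge0// subr_ge0.
Qed.

Lemma norm_unit_root t : 0 <= t <= 1 -> `|unit_root t| = 1.
Proof.
move=> t01; apply/eqP; rewrite -sqrp_eq1//.
by rewrite sqr_normc unit_root_mulJ.
Qed.

(** t - z is, up to the factor -1/(4s), the polynomial (1+s)^2 - 4 s t, whose
    roots are the two preimages of t on the unit circle.  *)
Lemma form_joukowski s t : 0 <= t <= 1 -> s != 0 ->
  form (joukowski s) lz t =
  s * (- 4 / (1 - (unit_root t)^*%C * s) / (1 - unit_root t * s)).
Proof.
move=> t01 s0; rewrite /form /= /joukowski.
have E : (1 - (unit_root t)^*%C * s) * (1 - unit_root t * s) =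
    (1 + s) ^+ 2 - 4 * s * (t%:C)%C.
  transitivity (1 - s * (unit_root t + (unit_root t)^*%C) +
    (unit_root t * (unit_root t)^*%C) * s ^+ 2); first by ring.
  rewrite unit_root_mulJ// addcJ /unit_root /=.
  rewrite (_ : (2 * t - 1)%:C%C = 2 * (t%:C)%C - 1 :> K); first by ring.
  by rewrite rmorphB rmorphM rmorph1 rmorph_nat.
rewrite -(mulrA (- 4)) -invfM E.
have -> : (t%:C)%C - (1 + s) ^+ 2 / (4 * s) =
    ((1 + s) ^+ 2 - 4 * s * (t%:C)%C) * (- (4 * s)^-1).
  by field; rewrite s0.
rewrite invfM invrN invrK mulrC; ring.
Qed.

(** The power series of the integrand of a word at [t]: a letter e_z contributes
    -4s and two geometric series, the other letters a factor free of s.  *)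
Fixpoint word_coef (a : nat -> letter) n (t : nat -> R) : nat -> K :=
  if n is n'.+1 then
    if a n' == lz then
      shift_coef (geom_coef (unit_root (t n')) (geom_coef (unit_root (t n'))^*%C
        (fun k => - 4 * word_coef a n' t k)))
    else fun k => form 0 (a n') (t n') * word_coef a n' t k
  else fun k => (k == 0%N)%:R.

Definition letter_majorant (l : letter) (t : R) : R :=
  match l with l0 => t^-1 | l1 => (1 - t)^-1 | lz => 4 end.

Lemma letter_majorant_le n (a : nat -> letter) i t : admissible n a -> (i < n)%N -> 0 < t < 1 ->
  letter_majorant (a i) t <= 4 * majorant n i t.
Proof.
move=> adm lin /andP[t0 t1]; have [a0 a1] := adm i lin.
have ti : 1 <= t^-1 by rewrite invf_ge1// ltW.
have ti' : 1 <= (1 - t)^-1 by rewrite invf_ge1 ?subr_gt0// gerBl ltW.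
(* From this nra deduces that u v is at least u and at least v. *)
have tt : 0 <= (t^-1 - 1) * ((1 - t)^-1 - 1) by rewrite mulr_ge0 ?subr_ge0.
rewrite /majorant; move: ti ti' tt; set u := t^-1; set v := (1 - t)^-1 => u1 v1 uv.
case: (i =P 0%N) a0 => [i0 /(_ i0)|_ _]; case: (i =P n.-1) a1 => [i1 /(_ i1)|_ _];
  case: (a i) => /= *; rewrite -?/u -?/v; try congruence; clear adm lin; nra.
Qed.

(** Each of the at most n letters e_z costs two geometric series, hence the
    exponent 2n.  *)
Lemma expansion_prod_form (a : nat -> letter) n (t : nat -> R) : (forall i, (i < n)%N -> 0 < t i < 1) ->
  expansion (fun s => \prod_(i < n) form (joukowski s) (a i) (t i)) (word_coef a n t)
    ((\prod_(i < n) letter_majorant (a i) (t i))%:C)%C (n.*2).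
Proof.
elim: n => [_|n IH t01].
  rewrite big_ord0; apply: expansion_ext (expansion1 K) => s _ _.
  by rewrite big_ord0.
have {}IH := IH (fun i lin => t01 i (ltnW lin)).
have tn : 0 <= t n <= 1 by have /andP[/ltW -> /ltW ->] := t01 n (ltnSn n).
have u1 := norm_unit_root tn.
have -> : ((\prod_(i < n.+1) letter_majorant (a i) (t i))%:C)%C =
    ((letter_majorant (a n) (t n))%:C)%C * ((\prod_(i < n) letter_majorant (a i) (t i))%:C)%C :> K.
  by rewrite big_ord_recr rmorphM mulrC.
rewrite /=.
case: (a n =P lz) => [an|/eqP an].
  have H1 := expansionZ (- 4) IH.
  rewrite (_ : `|- 4| = 4 :> K) in H1; last by rewrite normrN ger0_norm.
  have J1 : `|(unit_root (t n))^*%C| <= 1 by rewrite normcJ u1.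
  have J2 : `|unit_root (t n)| <= 1 by rewrite u1.
  have := expansion_shift (expansion_geom J2 (expansion_geom J1 H1)).
  rewrite an.
  rewrite (_ : ((letter_majorant lz (t n))%:C)%C = 4 :> K); last by rewrite rmorph_nat.
  apply: expansion_ext => s s0 s1.
  by rewrite big_ord_recr /= an form_joukowski//; ring.
have := expansionZ (form 0 (a n) (t n)) IH.
have -> : `|form 0 (a n) (t n)| = ((letter_majorant (a n) (t n))%:C)%C.
  have /andP[t0 t1] := tn; rewrite /form; case: (a n) an => [_|_|/eqP//] /=; rewrite normfV ?subr0.
    by rewrite ger0_norm ?fmorphV// ler0c.
  rewrite distrC ger0_norm ?fmorphV ?rmorphB ?rmorph1//.
  by rewrite -(rmorph1 (real_complex R)) -rmorphB ler0c subr_ge0.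
move=> H; apply: expansion_weaken; [exact: lexx| |]; last first.
  apply: expansion_ext H => s _ _; rewrite big_ord_recr /= mulrC.
  by case: (a n) an => // /eqP.
by rewrite doubleS -addn2 leq_addr.
Qed.

Lemma path_rcons_lt (x : R) (s : seq R) y : path <%R x (rcons s y) -> x < y.
Proof.
elim: s x => [|u s IH] x /=; first by rewrite andbT.
by move=> /andP[xu /IH]; exact: lt_trans.
Qed.

Lemma path_rcons_bounds (x : R) (s : seq R) y i : path <%R x (rcons s y) ->
  (i < size s)%N -> x < nth 0 s i < y.
Proof.
elim: s x i => // u s IH x [|i] /= /andP[xu us]; first by rewrite xu (path_rcons_lt us).
by rewrite ltnS => /(IH _ _ us) /andP[/(lt_trans xu) -> ->].
Qed.

Lemma simplex_bounds n (t : n.-tuple rT) i : simplex t -> (i < n)%N ->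
  0 < nth 0 t i < 1.
Proof. by move=> st lin; apply: path_rcons_bounds st _; rewrite size_tuple. Qed.

Lemma prod_letter_majorant_le n (a : nat -> letter) (t : n.-tuple rT) :
  admissible n a -> simplex t ->
  \prod_(i < n) letter_majorant (a i) (nth 0 t i) <=
  \prod_(i < n) (4 * on01 (majorant n i) (tnth t i)).
Proof.
move=> adm st; apply: ler_prod => i _.
have ti := simplex_bounds st (ltn_ord i).
rewrite (tnth_nth 0) /on01 ti letter_majorant_le// andbT.
have /andP[t0 t1] := ti.
by case: (a i) => //=; rewrite invr_ge0 ?subr_ge0 ltW.
Qed.

Section measurability.
Variables (n : nat) (D : set (n.-tuple rT)).

Lemma cmeasurable_form z l i :
  cmeasurable D (fun t : n.-tuple rT => form z l (nth 0 t i)).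
Proof.
have mt : measurable_fun D (fun t : n.-tuple rT => nth 0 t i : rT).
  by apply: measurable_funTS; exact: measurable_nth_tuple.
have mN (f : n.-tuple rT -> K) : cmeasurable D f -> cmeasurable D (fun t => (f t)^-1).
  move=> [mr mi].
  have mn : measurable_fun D (fun t => (complex.Re (f t) ^+ 2 + complex.Im (f t) ^+ 2)^-1 : rT).
    by apply: measurable_funV; apply: measurable_funD; exact: measurable_funX.
  have E : (fun t => (f t)^-1) = (fun t =>
     ((complex.Re (f t) / (complex.Re (f t) ^+ 2 + complex.Im (f t) ^+ 2)) +i*
      (- (complex.Im (f t) / (complex.Re (f t) ^+ 2 + complex.Im (f t) ^+ 2))))%C).
    by apply/funext => t; case: (f t).
  rewrite E; split => /=; first exact: measurable_funM.
  by apply: measurable_funN; exact: measurable_funM.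
apply: mN; apply: cmeasurableD; last exact: cmeasurable_cst.
exact: cmeasurable_real.
Qed.

Lemma cmeasurable_unit_root i :
  cmeasurable D (fun t : n.-tuple rT => unit_root (nth 0 t i)).
Proof.
have mt : measurable_fun D (fun t : n.-tuple rT => nth 0 t i : rT).
  by apply: measurable_funTS; exact: measurable_nth_tuple.
split => /=.
  by apply: measurable_funB => //; apply: measurable_funM.
apply: measurable_funM => //.
have ms : measurable_fun setT (@Num.sqrt R : rT -> rT).
  by apply: continuous_measurable_fun; exact: sqrt_continuous.
apply: (measurableT_comp ms); apply: measurable_funM => //.
exact: measurable_funB.
Qed.

Lemma cmeasurable_conj (f : n.-tuple rT -> K) :
  cmeasurable D f -> cmeasurable D (fun t => (f t)^*%C).
Proof.
move=> [mr mi]; split.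
  by rewrite (_ : (fun _ => _) = (fun t => complex.Re (f t)))//; apply/funext => t; case: (f t).
rewrite (_ : (fun _ => _) = (fun t => - complex.Im (f t))); first exact: measurable_funN.
by apply/funext => t; case: (f t).
Qed.

Lemma cmeasurable_geom (b : n.-tuple rT -> K) (h : n.-tuple rT -> nat -> K) :
  cmeasurable D b -> (forall k, cmeasurable D (fun t => h t k)) ->
  forall k, cmeasurable D (fun t => geom_coef (b t) (h t) k).
Proof.
move=> mb mh; elim=> [|k IH] /=; first exact: mh.
by apply: cmeasurableD => //; exact: cmeasurableM.
Qed.

Lemma cmeasurable_coef (a : nat -> letter) m k :
  cmeasurable D (fun t : n.-tuple rT => word_coef a m (nth 0 t) k).
Proof.
elim: m k => [|m IH] k; first exact: cmeasurable_cst.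
rewrite /word_coef -/word_coef; case: (a m == lz); last first.
  by apply: cmeasurableM => //; exact: cmeasurable_form.
case: k => [|k]; first exact: cmeasurable_cst.
apply: cmeasurable_geom; first exact: cmeasurable_unit_root.
apply: cmeasurable_geom; first exact/cmeasurable_conj/cmeasurable_unit_root.
by move=> j; apply: cmeasurableM => //; exact: cmeasurable_cst.
Qed.

Lemma cmeasurable_prod_form z (a : nat -> letter) :
  cmeasurable D (fun t : n.-tuple rT => \prod_(i < n) form z (a i) (tnth t i)).
Proof.
apply: cmeasurable_prod => i.
by under eq_fun do rewrite (tnth_nth 0); exact: cmeasurable_form.
Qed.

End measurability.

Lemma measurable_simplex0 n : measurable (@simplex R n).
Proof. exact: (@measurable_simplex R n 0). Qed.

Lemma integrable_majorant n : (lebesgue_tuple R n).-integrable (@simplex R n)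
  (fun t => (\prod_(i < n) (4 * on01 (majorant n i) (tnth t i)))%:E).
Proof.
have i1 : (lebesgue_tuple R n).-integrable (@simplex R n)
    (fun t => (\prod_(i < n) on01 (majorant n i) (tnth t i))%:E).
  apply/integrableP; split.
    apply: measurable_funTS; apply/measurable_EFinP.
    exact: (@measurable_prod_tuple R n (fun i => on01 (majorant n i)) (measurable_majorant n)).
  apply: (@le_lt_trans _ _ (upper_iter (fun i => on01 (majorant n i)) n 0 0));
    last exact: upper_iter_majorant_lty.
  rewrite -(@integral_simplex R (fun i => on01 (majorant n i)) n 0 0)//.
  - rewrite le_eqVlt; apply/orP; left; apply/eqP; apply: eq_integral => t _.
    by rewrite gee0_abs// lee_fin prodr_ge0// => i _; exact: on01_majorant_ge0.
  - exact: measurable_majorant.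
  - exact: on01_majorant_ge0.
  - by move=> i t; exact: on01_supp.
have := integrableZl (@measurable_simplex0 n) (4 ^+ n) i1.
apply: eq_integrable => //; first exact: measurable_simplex0.
by move=> t _; rewrite big_split /= prodr_const card_ord.
Qed.

Lemma expansion_word_integral n (a : nat -> letter) : admissible n a ->
  exists h C, expansion (fun s => word_integral (joukowski s) n a) h C n.*2.
Proof.
move=> adm; eexists; eexists.
apply: (@expansion_cintegral _ _ R (lebesgue_tuple R n) _ (@measurable_simplex0 n) _
  (fun t => word_coef a n (nth 0 t)) (fun t => \prod_(i < n) (4 * on01 (majorant n i) (tnth t i)))).
- exact: integrable_majorant.
- by move=> k; exact: cmeasurable_coef.
- by move=> s; exact: cmeasurable_prod_form.
move=> t st.
have := @expansion_prod_form a n (nth 0 t) (fun i => simplex_bounds st).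
under [X in expansion X]eq_fun do under eq_bigr do rewrite -(tnth_nth 0).
by apply: expansion_weaken => //; rewrite lecR prod_letter_majorant_le.
Qed.

Lemma cintegrable_prod_form n (a : nat -> letter) s : admissible n a ->
  s != 0 -> `|s| < 1 ->
  cintegrable (lebesgue_tuple R n) (@simplex R n)
    (fun t => \prod_(i < n) form (joukowski s) (a i) (tnth t i)).
Proof.
move=> adm s0 s1.
have [k k0 kE] : exists2 k : R, 0 <= k & ((1 - `|s|) ^+ n.*2)^-1 = (k%:C)%C.
  by apply: complex_ge0E; rewrite invr_ge0 exprn_ge0// subr_ge0 ltW.
pose b (t : n.-tuple rT) := k * \prod_(i < n) (4 * on01 (majorant n i) (tnth t i)).
have ib : (lebesgue_tuple R n).-integrable (@simplex R n) (EFin \o b).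
  exact: (integrableZl (@measurable_simplex0 n) k (integrable_majorant n)).
have := cintegral_dominated (@measurable_simplex0 n)
  (cmeasurable_prod_form (@simplex R n) (joukowski s) a) ib.
case=> // t st.
have [_ /(_ 0%N s s0 s1)] := @expansion_prod_form a n (nth 0 t) (fun i => simplex_bounds st).
rewrite big_ord0 subr0 expr1n mulr1 expr0 mulr1 kE -rmorphM mulrC.
under eq_bigr do rewrite -(tnth_nth 0).
move=> H; apply: (le_trans H); by rewrite lecR ler_wpM2l// prod_letter_majorant_le.
Qed.

End word_integral.

(** * Duality for real z > 1 *)

Lemma big_letter (V : nmodType) (F : letter -> V) :
  \sum_l F l = F l0 + F l1 + F lz.
Proof.
have codeK : cancel letter_decode letter_code.
  by case=> [[|[|[|//]]] i3]; apply: val_inj; rewrite /= inordK.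
rewrite (reindex letter_decode) /=; last first.
  by apply: onW_bij; exists letter_code; [exact: codeK|exact: letter_codeK].
by rewrite !big_ord_recr big_ord0 /= add0r.
Qed.

Definition tau_coef (l l' : letter) : rat :=
  match l, l' with
  | l0, lz | l1, lz | lz, lz => 1
  | l0, l1 | l1, l0 => -1
  | _, _ => 0
  end.

(** The coefficient of the word [f] in the image under tau of the word [a] of
    length [n].  *)
Definition dual_coef n (a f : nat -> letter) : rat :=
  \prod_(i < n) tau_coef (a (n - i.+1)%N) (f i).

Lemma tau_letterE l : tau_letter l = \sum_l' tau_coef l l' *: e l'.
Proof.
rewrite big_letter; case: l => /=; rewrite ?scale0r ?scale1r ?scaleN1r ?add0r//.
  by rewrite addrC.
by rewrite addr0 addrC.
Qed.

(** tau(e_1) does not involve e_1, nor tau(e_0) the letter e_0; as tau also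
    exchanges the two ends of a word, only convergent words occur in the image
    of a convergent word.  *)
Lemma dual_coef_admissible n (a f : nat -> letter) : admissible n a ->
  dual_coef n a f != 0 -> admissible n f.
Proof.
move=> adm; rewrite /dual_coef prodf_seq_neq0 => /allP H i lin.
have n0 : (0 < n)%N by case: n lin {adm H}.
have {H} : tau_coef (a (n - i.+1)%N) (f i) != 0.
  by apply: (H (Ordinal lin)); rewrite mem_index_enum.
split=> E fi; move: H; rewrite fi E.
- have [] := adm (n - 1)%N; first by rewrite ltn_subrL.
  by rewrite subn1 => _ /(_ erefl); case: (a n.-1).
- rewrite prednK// subnn; have [+ _] := adm 0%N n0.
  by move=> /(_ erefl); case: (a 0%N).
Qed.

Section real_duality.
Variable R : realType.
Local Notation rT := (measurableTypeR R).
Local Notation K := R[i].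
Variable x : R.
Hypothesis x1 : 1 < x.

Definition letter_sign (l : letter) : R := if l is l0 then 1 else -1.

(** The absolute value on ]0,1[ of the form of a letter for real z = [x] > 1; the
    sign is [letter_sign].  *)
Definition abs_form (l : letter) : R -> R := on01 (fun t =>
  match l with l0 => t^-1 | l1 => (1 - t)^-1 | lz => (x - t)^-1 end).

(** The pull-back of [abs_form] by the Moebius involution.  *)
Definition dual_form (l : letter) (t : R) : R :=
  abs_form l (mobius x t) * on01 (mobius_deriv x) t.

Lemma measurable_abs_form l : measurable_fun setT (abs_form l : rT -> rT).
Proof.
apply: measurable_on01; case: l; apply: measurable_funV => //;
  exact: measurable_funB.
Qed.

Lemma abs_form_ge0 l t : 0 <= abs_form l t.
Proof.
have lt1x := x1.
rewrite /abs_form /on01; case: ifP => // /andP[t0 t1].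
by case: l; rewrite invr_ge0; lra.
Qed.

Lemma abs_form_supp l t : abs_form l t != 0 -> 0 < t < 1.
Proof. exact: on01_supp. Qed.

(** The duality for z = x > 1 at the level of nonnegative integrals: substitute
    phi in all variables at once.  *)
Lemma upper_iter_abs_form n (a : nat -> letter) :
  upper_iter (fun i => abs_form (a i)) n 0 0 =
  upper_iter (fun i => dual_form (a (n - i.+1)%N)) n 0 0.
Proof.
have lt1x := x1.
apply: (@upper_iter_duality R (mobius x) (on01 (mobius_deriv x)) _ _ _ _ _ _ _
  (fun i => abs_form (a i))).
- exact: measurable_mobius.
- apply: measurable_on01; exact: measurable_mobius_deriv.
- exact: on01_mobius_deriv_ge0.
- exact: mobius_tail.
- by move=> s /on01_supp; exact: mobius01.
- move=> y s /andP[y0 y1] /on01_supp/andP[s0 s1]; apply: mobius_anti; lra.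
- by move=> s /on01_supp.
- by move=> i; exact: measurable_abs_form.
- by move=> i t; exact: abs_form_ge0.
- by move=> i t; exact: abs_form_supp.
- exact: mobius1.
Qed.

Lemma form_real l t : 0 < t < 1 ->
  form (x%:C)%C l t = ((letter_sign l * abs_form l t)%:C)%C.
Proof.
move=> t01; rewrite /form /abs_form /on01 t01.
case: l => /=; rewrite ?mul1r ?mulN1r ?subr0 -?invrN ?opprB fmorphV//.
  by rewrite rmorphB rmorph1.
by rewrite rmorphB.
Qed.

(** The form of tau(e_l) is the pull-back of the form of e_l, with the same sign
    as the form of e_l.  *)
Lemma dual_form_real l t : 0 < t < 1 ->
  \sum_l' ratr (tau_coef l l') * form (x%:C)%C l' t =
  ((letter_sign l * dual_form l t)%:C)%C.
Proof.
move=> t01; have lt1x := x1; rewrite big_letter !form_real//.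
have m01 := mobius01 x1 t01.
have /andP[t0 t1] := t01.
rewrite /dual_form /abs_form /on01 m01 t01 /mobius /mobius_deriv.
have xt : x - t != 0 by rewrite subr_eq0; lra.
have xx : x - 1 != 0 by rewrite subr_eq0; lra.
have t0' : t != 0 by lra.
have t1' : 1 - t != 0 by rewrite subr_eq0; lra.
have E1 : 1 - x * (1 - t) / (x - t) = (t * (x - 1)) / (x - t) by field.
have E2 : x - x * (1 - t) / (x - t) = (x * (x - 1)) / (x - t) by field.
case: l => /=; rewrite ?rmorphN ?rmorph1 ?rmorph0 ?mul0r ?add0r ?addr0 ?mulN1r ?mul1r.
- rewrite -rmorphN -rmorphD; congr (_%:C)%C; field.
  by do ?[apply/andP; split] => //; lra.
- rewrite -rmorphN -rmorphD E1; congr (_%:C)%C; field.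
  by do ?[apply/andP; split] => //; lra.
- rewrite E2; congr (_%:C)%C; field.
  by do ?[apply/andP; split] => //; lra.
Qed.

Lemma cintegral_real n (sg : nat -> R) (h : nat -> rT -> rT) :
  (forall i, measurable_fun setT (h i)) -> (forall i t, 0 <= h i t) ->
  (forall i t, h i t != 0 -> 0 < t < 1) -> (forall i, sg i != 0) ->
  cintegrable (lebesgue_tuple R n) (@simplex R n)
    (fun t => ((\prod_(i < n) (sg i * h i (tnth t i)))%:C)%C) ->
  cintegral (lebesgue_tuple R n) (@simplex R n)
    (fun t => ((\prod_(i < n) (sg i * h i (tnth t i)))%:C)%C) =
  (((\prod_(i < n) sg i) * fine (upper_iter h n 0 0))%:C)%C.
Proof.
move=> mh h0 hsupp sg0 [ir _].
have c0 : \prod_(i < n) sg i != 0 by apply/prodf_neq0 => i _.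
have E (t : n.-tuple rT) : \prod_(i < n) (sg i * h i (tnth t i)) =
    (\prod_(i < n) sg i) * \prod_(i < n) h i (tnth t i) by rewrite big_split.
have ih : (lebesgue_tuple R n).-integrable (@simplex R n)
    (EFin \o (fun t => \prod_(i < n) h i (tnth t i))).
  have := integrableZl (@measurable_simplex0 R n) (\prod_(i < n) sg i)^-1 ir.
  apply: eq_integrable; first exact: measurable_simplex0.
  by move=> t _ /=; rewrite E -EFinM mulKf.
rewrite /cintegral; apply/eqP; rewrite eq_complex /=; apply/andP; split.
  under eq_Rintegral do rewrite E.
  rewrite RintegralZl//; last exact: measurable_simplex0.
  by rewrite -(@integral_simplex R h n 0 0).
by rewrite /Rintegral integral0.
Qed.

Lemma joukowski_real r : 0 < r < 1 ->
  exists2 y : R, 1 < y & joukowski (r%:C)%C = (y%:C)%C.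
Proof.
move=> /andP[r0 r1]; exists ((1 + r) ^+ 2 / (4 * r)).
  rewrite ltr_pdivlMr ?mulr_gt0// mul1r -subr_gt0.
  rewrite (_ : _ - _ = (1 - r) ^+ 2); last by ring.
  by rewrite exprn_gt0// subr_gt0.
by rewrite /joukowski rmorphM fmorphV !rmorphM rmorphD rmorph1 rmorph_nat.
Qed.

End real_duality.

Section real_duality_words.
Variable R : realType.
Local Notation rT := (measurableTypeR R).
Local Notation K := R[i].

Definition word_fun n (f : {ffun 'I_n -> letter}) : nat -> letter :=
  nth l0 (codom f).

Lemma word_funE n (f : {ffun 'I_n -> letter}) (i : 'I_n) : word_fun f i = f i.
Proof.
rewrite /word_fun (nth_map i) ?size_enum_ord//.
by rewrite nth_ord_enum.
Qed.

(** Expanding tau of the word multilinearly identifies the right-hand side with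
    one integral, of the product of the forms of the tau(e_l).  Both sides are
    then the same product of signs times the nonnegative integrals compared in
    [upper_iter_abs_form].  *)
Lemma word_integral_real_duality n (a : nat -> letter) (r : R) :
  admissible n a -> 0 < r < 1 ->
  word_integral (joukowski (r%:C)%C) n a =
  \sum_(f : {ffun 'I_n -> letter})
    ratr (dual_coef n a (word_fun f)) *
    word_integral (joukowski (r%:C)%C) n (word_fun f).
Proof.
move=> adm r01; have [r0 r1] := andP r01.
have [x x1 zx] := joukowski_real r01.
have s0 : (r%:C)%C != 0 :> K by rewrite fmorph_eq0 gt_eqF.
have s1 : `|(r%:C)%C| < 1 :> K by rewrite normc_real ger0_norm ?ltW// -(rmorph1 (real_complex R)) ltcR.
have iW b : admissible n b -> cintegrable (lebesgue_tuple R n) (@simplex R n)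
    (fun t => \prod_(i < n) form (x%:C)%C (b i) (tnth t i)).
  by move=> admb; have := cintegrable_prod_form admb s0 s1; rewrite zx.
pose sg i := letter_sign R (a i); pose sg' i := letter_sign R (a (n - i.+1)%N).
have sgn0 l : letter_sign R l != 0 by case: l; rewrite /= ?oner_eq0// oppr_eq0 oner_eq0.
have bnd (t : n.-tuple rT) (i : 'I_n) : simplex t -> 0 < tnth t i < 1.
  by move=> st; rewrite (tnth_nth 0); exact: simplex_bounds.
rewrite /word_integral zx.
have formE (t : n.-tuple rT) : simplex t ->
    \prod_(i < n) form (x%:C)%C (a i) (tnth t i) =
    ((\prod_(i < n) (sg i * abs_form x (a i) (tnth t i)))%:C)%C.
  move=> st; rewrite rmorph_prod; apply: eq_bigr => i _.
  by apply: form_real; exact: bnd.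
have iL := eq_cintegrable (mu := lebesgue_tuple R n) (@measurable_simplex0 R n) formE.
rewrite (eq_cintegral _ formE).
rewrite (cintegral_real (fun i => measurable_abs_form x (a i))
  (fun i => abs_form_ge0 x1 (a i)) (fun i => @abs_form_supp R x (a i))
  (fun i => sgn0 (a i)) (iL (iW _ adm))).
have iF (f : {ffun 'I_n -> letter}) :
    cintegrable (lebesgue_tuple R n) (@simplex R n) (fun t =>
      ratr (dual_coef n a (word_fun f)) *
      \prod_(i < n) form (x%:C)%C (word_fun f i) (tnth t i)).
  have [->|/(dual_coef_admissible adm) admf] := eqVneq (dual_coef n a (word_fun f)) 0.
    apply: (eq_cintegrable (@measurable_simplex0 R n) (f := fun=> 0)) => [t _|].
      by rewrite rmorph0 mul0r.
    exact: cintegrable0.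
  by apply: cintegrableZ; [exact: measurable_simplex0|exact: iW].
have [iS eS] := cintegral_sum (@measurable_simplex0 R n) (index_enum _) iF.
transitivity (cintegral (lebesgue_tuple R n) (@simplex R n) (fun t =>
   \sum_(f : {ffun 'I_n -> letter}) ratr (dual_coef n a (word_fun f)) *
      \prod_(i < n) form (x%:C)%C (word_fun f i) (tnth t i))); last first.
  rewrite eS; apply: eq_bigr => f _.
  have [->|/(dual_coef_admissible adm) admf] := eqVneq (dual_coef n a (word_fun f)) 0.
    rewrite rmorph0 mul0r (eq_cintegral _ (g := fun=> 0)) ?cintegral0// => t _.
    by rewrite mul0r.
  by rewrite cintegralZ//; [exact: measurable_simplex0|exact: iW].
have dualE (t : n.-tuple rT) : simplex t ->
   \sum_(f : {ffun 'I_n -> letter}) ratr (dual_coef n a (word_fun f)) *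
      \prod_(i < n) form (x%:C)%C (word_fun f i) (tnth t i) =
   ((\prod_(i < n) (sg' i * dual_form x (a (n - i.+1)%N) (tnth t i)))%:C)%C.
  move=> st; rewrite rmorph_prod.
  transitivity (\prod_(i < n) \sum_l ratr (tau_coef (a (n - i.+1)%N) l) *
      form (x%:C)%C l (tnth t i)); last first.
    by apply: eq_bigr => i _; apply: dual_form_real; [exact: x1|exact: bnd].
  rewrite bigA_distr_bigA; apply: eq_bigr => f _.
  rewrite rmorph_prod -big_split; apply: eq_bigr => i _.
  by rewrite word_funE.
have iD := eq_cintegrable (mu := lebesgue_tuple R n) (@measurable_simplex0 R n) dualE.
rewrite (eq_cintegral _ dualE).
rewrite (@cintegral_real R n sg' (fun i => dual_form x (a (n - i.+1)%N)) _ _ _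
  (fun i => sgn0 _) (iD iS)).
- rewrite upper_iter_abs_form//; congr (((_ * _)%:C)%C).
  by rewrite [LHS](reindex_inj rev_ord_inj).
- move=> i; apply: measurable_funM.
    by apply: (measurableT_comp (measurable_abs_form x _)); exact: measurable_mobius.
  by apply: measurable_on01; exact: measurable_mobius_deriv.
- by move=> i t; rewrite mulr_ge0 ?abs_form_ge0// on01_mobius_deriv_ge0.
- by move=> i t; rewrite mulf_eq0 negb_or => /andP[_ /on01_supp].
Qed.

End real_duality_words.

(** * Analytic continuation and the duality theorem *)

Section analytic_continuation.
Variable R : realType.
Local Notation K := R[i].

(** The equation z = (1+s)^2/(4s) is quadratic in s, and its two roots have
    product 1.  So one of them lies in the open disc unless both have modulus 1,
    in which case 1/s = conj s makes z = (1 + Re s)/2 a point of [0,1].  *)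
Lemma joukowski_surj (z : K) : (forall t : R, 0 <= t <= 1 -> z <> (t%:C)%C) ->
  exists s : K, [/\ s != 0, `|s| < 1 & z = joukowski s].
Proof.
move=> hz; pose w := 2 * z - 1; pose q := sqrtc (w ^+ 2 - 1).
have qq : q ^+ 2 = w ^+ 2 - 1 by rewrite sqr_sqrtc.
have m1 : (w + q) * (w - q) = 1 by rewrite mulrC -subr_sqr qq; ring.
have s10 : w + q != 0.
  by apply: contra_eq_neq m1 => ->; rewrite mul0r eq_sym oner_eq0.
have s20 : w - q != 0.
  by apply: contra_eq_neq m1 => ->; rewrite mulr0 eq_sym oner_eq0.
have jE s : s != 0 -> s ^+ 2 + 1 = 2 * w * s -> z = joukowski s.
  move=> s0 sw; rewrite /joukowski (_ : (1 + s) ^+ 2 = z * (4 * s)).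
    by rewrite mulfK// mulf_neq0// pnatr_eq0.
  by rewrite (_ : _ ^+ 2 = s ^+ 2 + 1 + 2 * s); [rewrite sw /w; ring|ring].
have j1 : z = joukowski (w + q).
  apply: jE => //; rewrite sqrrD qq; ring.
have j2 : z = joukowski (w - q).
  apply: jE => //; rewrite sqrrB qq; ring.
have nm : `|w + q| * `|w - q| = 1 by rewrite -normrM m1 normr1.
have [lt1|gt1|eq1] := real_ltgtP (normr_real (w + q)) (@real1 K).
- by exists (w + q).
- exists (w - q); split => //.
  have : 0 < `|w - q| by rewrite normr_gt0.
  by move=> p; rewrite -nm -[ltLHS]mul1r ltr_pM2r.
exfalso; set s := w + q in s10 j1 eq1.
have sJ : s * s^*%C = 1 by rewrite -sqr_normc eq1 expr1n.
have zE : z = (((1 + complex.Re s) / 2)%:C)%C.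
  have -> : (((1 + complex.Re s) / 2)%:C)%C = (1 + (complex.Re s)%:C%C) / 2 :> K.
    by rewrite rmorphM fmorphV rmorphD rmorph1 rmorph_nat.
  rewrite j1 /joukowski.
  have : 2 * (complex.Re s)%:C%C = s + s^*%C by rewrite addcJ.
  move=> H; have -> : (complex.Re s)%:C%C = (s + s^*%C) / 2 by rewrite -H mulrC mulKf// pnatr_eq0.
  apply: (@mulIf _ (4 * s)); first by rewrite mulf_neq0// pnatr_eq0.
  rewrite divfK ?mulf_neq0 ?pnatr_eq0//.
  transitivity (s ^+ 2 + 2 * s + s * s^*%C); first by rewrite sJ; ring.
  by field.
have /(hz _) : 0 <= (1 + complex.Re s) / 2 <= 1.
  have [] : `|complex.Re s| <= 1 /\ `|complex.Im s| <= 1.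
    by apply: normc_leP; rewrite eq1 rmorph1.
  by rewrite ler_norml => /andP[? ?] _; lra.
by rewrite zE.
Qed.

(** In the variable s the difference of the two sides is a power series that
    vanishes on ]0,1[.  *)
Lemma word_integral_duality (z : K) n (a : nat -> letter) :
  (forall t : R, 0 <= t <= 1 -> z <> (t%:C)%C) -> admissible n a ->
  word_integral z n a = \sum_(f : {ffun 'I_n -> letter})
    ratr (dual_coef n a (word_fun f)) * word_integral z n (word_fun f).
Proof.
move=> /joukowski_surj[s [s0 s1 ->]] adm.
pose F (u : K) : K := word_integral (joukowski u) n a + -1 * \sum_(f : {ffun 'I_n -> letter})
    ratr (dual_coef n a (word_fun f)) * word_integral (joukowski u) n (word_fun f).
have [h [C E]] : exists h C, expansion F h C n.*2.
  have [h1 [C1 E1]] := expansion_word_integral R adm.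
  suff [h2 [C2 E2]] : exists h C, expansion (fun u : K => \sum_(f : {ffun 'I_n -> letter})
    ratr (dual_coef n a (word_fun f)) * word_integral (joukowski u) n (word_fun f)) h C n.*2.
    by do 2 eexists; exact: (expansionD E1 (expansionZ (-1) E2)).
  elim: (index_enum _) => [|f r [h2 [C2 E2]]].
    exists (fun=> 0), 0; apply: expansion_ext (expansion0 K n.*2) => u _ _.
    by rewrite big_nil.
  have [h3 [C3 E3]] : exists h C, expansion (fun u : K =>
      ratr (dual_coef n a (word_fun f)) * word_integral (joukowski u) n (word_fun f)) h C n.*2.
    have [d0|d0] := eqVneq (dual_coef n a (word_fun f)) 0.
      exists (fun=> 0), 0; apply: expansion_ext (expansion0 K n.*2) => u _ _.
      by rewrite d0 rmorph0 mul0r.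
    have [h3 [C3 E3]] := expansion_word_integral R (dual_coef_admissible adm d0).
    by do 2 eexists; exact: (expansionZ _ E3).
  do 2 eexists; apply: expansion_ext (expansionD E3 E2) => u _ _.
  by rewrite big_cons.
have F0 (r : R) : 0 < r < 1 -> F (r%:C)%C = 0.
  by move=> r01; rewrite /F (word_integral_real_duality adm r01) mulN1r subrr.
have := expansion_eq0 E F0 s0 s1.
by rewrite /F mulN1r => /eqP; rewrite subr_eq0 => /eqP.
Qed.

End analytic_continuation.

Section words.
Variable R : realType.
Local Notation K := R[i].

Lemma L_wordE (z : K) (m : word) : L_word z m = word_integral z (size m) (nth l0 m).
Proof.
rewrite /L_word /iterated_integral /word_integral; congr (cintegral _ _ _).
apply/funext => t; apply: eq_bigr => i _.
by rewrite /form tnth_map (tnth_nth l0).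
Qed.

Lemma L_supp (z : K) (w : calA) (d : {fset word}) : (msupp w `<=` d)%fset ->
  L z w = \sum_(m <- d) ratr w@_m * L_word z m.
Proof.
move=> le; rewrite /L (big_fset_incl _ le) // => m _ /mcoeff_outdom ->.
by rewrite rmorph0 mul0r.
Qed.

Lemma L_linear (z : K) (c : rat) (v w : calA) :
  L z (c *: v + w) = ratr c * L z v + L z w.
Proof.
pose d := (msupp v `|` msupp w `|` msupp (c *: v + w))%fset.
have dv : (msupp v `<=` d)%fset by rewrite /d -fsetUA; apply: fsubsetUl.
have dw : (msupp w `<=` d)%fset by rewrite /d fsetUAC; apply: fsubsetUr.
have dvw : (msupp (c *: v + w) `<=` d)%fset by exact: fsubsetUr.
rewrite (L_supp z dv) (L_supp z dw) (L_supp z dvw) mulr_sumr -big_split /=.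
by apply: eq_bigr => m _; rewrite mcoeffD mcoeffZ rmorphD rmorphM mulrDl mulrA.
Qed.

Lemma L0 (z : K) : L z 0 = 0.
Proof. by rewrite /L msupp0 big_nil. Qed.

Lemma L_sum (z : K) I (r : seq I) (c : I -> rat) (F : I -> calA) :
  L z (\sum_(i <- r) c i *: F i) = \sum_(i <- r) ratr (c i) * L z (F i).
Proof.
elim: r => [|i r IH]; first by rewrite !big_nil L0.
by rewrite !big_cons L_linear IH.
Qed.

Lemma prod_e (s : seq letter) : \prod_(l <- s) e l = << FMonom s >> :> calA.
Proof.
elim: s => [|l s IH]; first by rewrite big_nil -fmoneE.
rewrite big_cons IH /e malg_monomM.
have -> // : mmul (fmu l) (FMonom s) = FMonom (l :: s).
by apply: val_inj; rewrite /= fmM fmU.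
Qed.

Lemma prodrZ I (r : seq I) (c : I -> rat) (F : I -> calA) :
  \prod_(i <- r) (c i *: F i) = (\prod_(i <- r) c i) *: \prod_(i <- r) F i.
Proof.
elim: r => [|i r IH]; first by rewrite !big_nil scale1r.
rewrite !big_cons IH; exact: malg_scaleM.
Qed.

Lemma tau_wordE (m : word) : tau_word m =
  \sum_(f : {ffun 'I_(size m) -> letter})
    dual_coef (size m) (nth l0 m) (word_fun f) *: << FMonom (codom f) >>.
Proof.
rewrite /tau_word (big_nth l0) size_rev big_mkord.
under eq_bigr => i _ do rewrite tau_letterE.
rewrite bigA_distr_bigA; apply: eq_bigr => f _; rewrite prodrZ; congr (_ *: _).
  by apply: eq_bigr => i _; rewrite word_funE nth_rev.
by rewrite -prod_e codomE big_map enumT [index_enum _]unlock.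
Qed.

Lemma L_tau_word (z : K) (m : word) :
  (forall t : R, 0 <= t <= 1 -> z <> (t%:C)%C) ->
  admissible (size m) (nth l0 m) -> L z (tau_word m) = L_word z m.
Proof.
move=> hz adm; rewrite tau_wordE L_sum L_wordE (word_integral_duality hz adm).
apply: eq_bigr => f _; rewrite L_monom L_wordE; congr (_ * word_integral _ _ _).
by rewrite /= size_codom card_ord.
Qed.

Definition admissible_word (m : word) := admissible (size m) (nth l0 m).

(** Every word of such a product starts with [a] and ends with [b].  *)
Lemma admissible_sandwich (a b : letter) (p : calA) m : a <> l0 -> b <> l1 ->
  (e a * p * e b)@_m != 0 -> admissible_word m.
Proof.
move=> al0 bl1.
have -> : e a * p * e b = \sum_(k <- msupp p) p@_k *: << FMonom (a :: rcons k b) >>.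
  rewrite {1}(malg_sumE p) mulr_sumr mulr_suml; apply: eq_bigr => k _.
  rewrite -malg_scalerAr -scalerAl /e !malg_monomM; congr (_ *: << _ >>).
  by apply: val_inj; rewrite /= !fmM !fmU -cats1.
rewrite linear_sum /= => /eqP sn0.
have [k _ kn0] : exists2 k, k \in msupp p & (p@_k *: << FMonom (a :: rcons k b) >> : calA)@_m != 0.
  apply/hasP; apply: contra_notT sn0 => /hasPn H.
  by rewrite big_seq big1// => k /H /negPn/eqP.
move: kn0; rewrite mcoeffZ mcoeffU mulf_eq0 negb_or => /andP[_].
case: (_ =P m) => [<- _|_]; last by rewrite mulr0n eqxx.
rewrite /admissible_word /= size_rcons => i _; split=> [->//|->] /=.
by rewrite nth_rcons ltnn eqxx.
Qed.

Lemma sum6_neq0 (V : zmodType) (x1 x2 x3 x4 x5 x6 : V) :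
  x1 + x2 + x3 + x4 + x5 + x6 != 0 ->
  [|| x1 != 0, x2 != 0, x3 != 0, x4 != 0, x5 != 0 | x6 != 0].
Proof.
apply: contraNT; rewrite !negb_or !negbK.
by move=> /and5P[/eqP-> /eqP-> /eqP-> /eqP-> /andP[/eqP-> /eqP->]]; rewrite !addr0.
Qed.

Lemma admissible_msupp (w : calA) m : calA0 w -> w@_m != 0 -> admissible_word m.
Proof.
case=> c [d [p [q [r [s ->]]]]]; rewrite !mcoeffD => H.
have {H} := sum6_neq0 H.
case/orP=> [|/orP[]].
- rewrite mcoeffZ. rewrite mcoeff1. rewrite mulf_eq0 negb_or => /andP[_].
  by case: (m =P _) => [-> _|_]; [rewrite /admissible_word fm1|rewrite mulr0n eqxx].
- rewrite mcoeffZ. rewrite mcoeffU. rewrite mulf_eq0 negb_or => /andP[_].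
  case: (_ =P m) => [<- _|_]; last by rewrite mulr0n eqxx.
  by rewrite /admissible_word fmU => -[].
by case/or4P; apply: admissible_sandwich.
Qed.

End words.

Theorem theorem1p1 (R : realType) (z : R[i])
    (hz : forall t : R, 0 <= t <= 1 -> z <> (t%:C)%C)
    (w : calA) (hw : calA0 w) :
  L z (w - tau w) = 0.
Proof.
rewrite addrC -scaleN1r L_linear rmorphN1 mulN1r /tau L_sum addrC.
apply/eqP; rewrite subr_eq0; apply/eqP.
rewrite [LHS]/L big_seq [RHS]big_seq; apply: eq_bigr => m mw.
rewrite L_tau_word//; apply: admissible_msupp hw _.
by rewrite mcoeff_neq0.
Qed.
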